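(* There exists a minimizer of the signal space uncertainty $\mathcal{L}_{\rm S}$ in its domain: there is a nonzero $f_0\in \operatorname{Dom}(\mathcal{L}_{\rm S})$ such that $\mathcal{L}_{\rm S}(f_0)\le \mathcal{L}_{\rm S}(f)$ for every nonzero $f\in\operatorname{Dom}(\mathcal{L}_{\rm S})$.
   Context: $\mathbb{R}^+$ denotes the positive reals. $\mathcal{S}=L^2(\mathbb{R}^+)$ is the space of (complex-valued) $f\in L^2(\mathbb{R})$ supported in $\mathbb{R}^+$, with the usual $L^2$ inner product $\langle f,g\rangle_{\mathcal S}=\int_0^\infty f\overline{g}\,d\omega$ and norm $\|\cdot\|_{\mathcal S}$. The time observable is $T_xf(\omega)=i f'(\omega)$, with domain $\operatorname{Dom}(T_x)$ the set of $f\in L^2(\mathbb{R}^+)$ that (viewed as functions on $\mathbb{R}$ vanishing on $(-\infty,0)$) are absolutely continuous on every compact interval $[a,b]\subset\mathbb{R}$ (so $f(0)=0$) and have $f'\in L^2(\mathbb{R})$. The scale observable is $T_\sigma f(\omega)=-\ln(\omega)f(\omega)$, with domain $\operatorname{Dom}(T_\sigma)=\{f\in L^2(\mathbb{R}^+): \ln(\omega)f(\omega)\in L^2(\mathbb{R}^+)\}$. For $T\in\{T_x,T_\sigma\}$ and $g\in\operatorname{Dom}(T)$ with $\|g\|_{\mathcal S}=1$, put $e_g(T)=\langle Tg,g\rangle_{\mathcal S}$ and $v_g(T)=\|(T-e_g(T))g\|_{\mathcal S}^2$. The signal space uncertainty of a nonzero $f\in\operatorname{Dom}(\mathcal{L}_{\rm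 S})=\operatorname{Dom}(T_x)\cap\operatorname{Dom}(T_\sigma)$ is, with $g=f/\|f\|_{\mathcal S}$, $$\mathcal{L}_{\rm S}(f)=e^{-2e_g(T_\sigma)}\,v_g(T_x)+v_g(T_\sigma).$$ *)

(* Defs.v *)
From HB Require Import structures.
From mathcomp Require Import all_boot all_order all_algebra.
From mathcomp Require Import complex.
From mathcomp Require Import all_classical all_reals all_analysis.

Set Implicit Arguments.
Unset Strict Implicit.
Unset Printing Implicit Defensive.

Import Order.TTheory GRing.Theory Num.Theory.
Import numFieldNormedType.Exports.
Import mathcomp.real_closed.complex.

Local Open Scope classical_set_scope.
Local Open Scope ring_scope.
Local Open Scope complex_scope.

(* Elements of L^2 are handled through representatives [R -> R[i]]. [Re], [Im]
   and the complex modulus [cmod] all take values in [R]; the library norm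
   [`|z|] would take values in [R[i]]. *)

Definition cmod (R : realType) (z : R[i]) : R := Num.sqrt (Re z ^+ 2 + Im z ^+ 2).

Lemma cmodE (R : realType) (z : R[i]) : `|z| = (cmod z)%:C.
Proof. exact: normc_def. Qed.

Definition memL2 (R : realType) (f : R -> R[i]) : Prop :=
  [/\ measurable_fun [set: R] (fun x => Re (f x)),
      measurable_fun [set: R] (fun x => Im (f x)) &
      (\int[lebesgue_measure]_x (cmod (f x) ^+ 2)%:E < +oo)%E].

Definition signal (R : realType) (f : R -> R[i]) : Prop :=
  memL2 f /\ forall x, x < 0 -> f x = 0.

Definition nonzero_signal (R : realType) (f : R -> R[i]) : Prop :=
  ~ {ae lebesgue_measure, forall x : R, f x = 0}.

Definition inner (R : realType) (f g : R -> R[i]) : R[i] :=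
  (\int[lebesgue_measure]_(w in `]0%R, +oo[) Re (f w * conjc (g w))) +i*
  (\int[lebesgue_measure]_(w in `]0%R, +oo[) Im (f w * conjc (g w))).

Definition norm2 (R : realType) (f : R -> R[i]) : R :=
  Num.sqrt (\int[lebesgue_measure]_(w in `]0%R, +oo[) (cmod (f w) ^+ 2)).

Definition abs_cont_on (R : realType) (a b : R) (f : R -> R[i]) : Prop :=
  forall e : R, 0 < e -> exists2 d : R, 0 < d &
    forall (n : nat) (s t : 'I_n -> R),
      (forall i, [/\ a <= s i, s i < t i & t i <= b]) ->
      (forall i j, i != j -> t i <= s j \/ t j <= s i) ->
      \sum_(i < n) (t i - s i) < d ->
      \sum_(i < n) cmod (f (t i) - f (s i)) < e.

(* At a point where [Re f] or [Im f] is not differentiable the value is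
   unspecified; for locally absolutely continuous [f] such points form a
   Lebesgue-null set. *)
Definition cderiv (R : realType) (f : R -> R[i]) (x : R) : R[i] :=
  (derive1 (fun y => Re (f y)) x) +i* (derive1 (fun y => Im (f y)) x).

Definition Tx (R : realType) (f : R -> R[i]) : R -> R[i] :=
  fun w => (0 +i* 1) * cderiv f w.

(* [f] is the absolutely continuous representative of its L^2 class. *)
Definition dom_Tx (R : realType) (f : R -> R[i]) : Prop :=
  [/\ signal f,
      forall a b : R, a <= b -> abs_cont_on a b f &
      memL2 (cderiv f)].

Definition Tsigma (R : realType) (f : R -> R[i]) : R -> R[i] :=
  fun w => (- ln w)%:C * f w.

(* [ln w = 0] for [w <= 0], so this is [ln(w) f(w)] extended by [0] to the left
   of the origin. *)
Definition dom_Tsigma (R : realType) (f : R -> R[i]) : Prop :=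
  signal f /\ signal (fun w => (ln w)%:C * f w).

Definition mean (R : realType) (T : (R -> R[i]) -> R -> R[i])
  (g : R -> R[i]) : R[i] := inner (T g) g.

Definition variance (R : realType) (T : (R -> R[i]) -> R -> R[i])
  (g : R -> R[i]) : R := norm2 (fun w => T g w - mean T g * g w) ^+ 2.

(* The exponent in [LS] below is taken through [Re]; no information is lost. *)
Lemma Im_mean_Tsigma (R : realType) (g : R -> R[i]) :
  Im (mean (@Tsigma R) g) = 0.
Proof.
rewrite /mean /inner /= /Rintegral.
under eq_integral => w _.
  have -> : Im (Tsigma g w * conjc (g w)) = 0.
    rewrite /Tsigma; case: (g w) => a b /=.
    by rewrite !mul0r addr0 subr0 mulrN mulrAC; simpc.
  over.
by rewrite integral0.
Qed.

Definition normalize (R : realType) (f : R -> R[i]) : R -> R[i] :=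
  fun w => (norm2 f)^-1%:C * f w.

Definition LS (R : realType) (f : R -> R[i]) : R :=
  let g := normalize f in
  expR (- 2 * Re (mean (@Tsigma R) g)) * variance (@Tx R) g
  + variance (@Tsigma R) g.

Definition dom_LS (R : realType) (f : R -> R[i]) : Prop :=
  dom_Tx f /\ dom_Tsigma f.

(* Main.v *)
Require Import Defs.
From HB Require Import structures.
From mathcomp Require Import all_boot all_order all_algebra.
From mathcomp Require Import complex.
From mathcomp Require Import all_classical all_reals all_analysis.
From mathcomp Require Import measurable_realfun.
From mathcomp Require Import ring lra.

(** The functional is invariant under dilations [f |-> f (k x)], and replacing a
    signal by its modulus does not increase it: the logarithmic moments depend on
    [|f|] only, while the variance of [Tx] is the integral of [|f' + i c f| ^ 2]
    for [c] the mean frequency, a modulation of [f], and the derivative of [|f|]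
    is pointwise bounded by [|f' + i c f|] ([diamagnetic], [modulus_pair]). So
    every signal has a competitor ([signal_competitor]) which is a real function
    [u] with [int u ^ 2 = 1], [int ln u ^ 2 = 0], and for such functions the
    uncertainty is the quadratic [energy], the integral of
    [u' ^ 2 + ln ^ 2 u ^ 2] ([LS_real_signal]).

    The energy is minimized by the direct method. Bounded kinetic energy gives a
    modulus of absolute continuity common to a minimizing sequence
    ([hlf_modulus]), hence a pointwise convergent subsequence
    ([pointwise_subsequence]), and the limit is again absolutely continuous. The
    growth of [ln ^ 2] at both ends of the half-line prevents mass and
    logarithmic mean from escaping, so that both constraints hold for the limit
    [v]. The energy is lower semicontinuous: the square norm of a difference
    quotient is at most the kinetic energy ([hlf_quotient]), so Fatou's lemma, used
    along the sequence for a fixed quotient and then as the increment tends to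
    [0], bounds the energy of [v] by the infimum ([minimizing_limit]).

    Underneath lies the fact that a locally absolutely continuous function is
    almost everywhere differentiable and is the integral of its derivative
    ([lac_ftc]). Such a function is locally the difference of two absolutely
    continuous monotone functions, built from the total variation; their Stieltjes
    measures are dominated by the Lebesgue measure ([stieltjes_dominated]), and the
    Radon-Nikodym theorem together with Lebesgue's differentiation theorem gives
    the derivative. It also yields [int w w' = 0] ([int_mul_derive]), which makes
    the mean of [Tx] real. *)

Set Implicit Arguments.
Unset Strict Implicit.
Unset Printing Implicit Defensive.

Import Order.TTheory GRing.Theory Num.Theory.
Import numFieldNormedType.Exports.
Import mathcomp.real_closed.complex.

Local Open Scope classical_set_scope.
Local Open Scope ring_scope.
Local Open Scope complex_scope.

(** * Total variation of absolutely continuous functions *)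

Definition spaced {R : realType} (p q : R * R) := (p.2 <= q.1) || (q.2 <= p.1).

Definition increment_family {R : realType} (l : seq (R * R)) :=
  all (fun p => p.1 <= p.2) l && pairwise spaced l.

(** Families of intervals are lists here, not functions on ['I_n] as in
    [abs_cont_on], because the arguments below refine and concatenate them. *)
Definition ac {R : realType} (f : R -> R) : Prop :=
  forall e : R, 0 < e -> exists2 d : R, 0 < d & forall l : seq (R * R),
    increment_family l ->
    \sum_(p <- l) (p.2 - p.1) < d -> \sum_(p <- l) `|f p.2 - f p.1| < e.

Section Variation.
Context {R : realType}.
Implicit Types (f : R -> R) (l : seq (R * R)).

Fixpoint steps (a : R) (s : seq R) : seq (R * R) :=
  if s is x :: s' then (a, x) :: steps x s' else [::].

Lemma steps_bounds a s : path <%R a s ->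
  a <= last a s /\
  all (fun p : R * R => [&& a <= p.1, p.1 <= p.2 & p.2 <= last a s]) (steps a s).
Proof.
elim: s a => [|x s IH] a /=; first by [].
move=> /andP[ax /IH[xs H]]; split; first exact: le_trans (ltW ax) xs.
rewrite lexx (ltW ax) xs /=.
by apply: sub_all H => p /and3P[xp -> ->]; rewrite (le_trans (ltW ax) xp).
Qed.

Lemma steps_family a s : path <%R a s -> increment_family (steps a s).
Proof.
rewrite /increment_family.
elim: s a => [|x s IH] a //= /andP[ax xs].
rewrite (ltW ax) /=; have /andP[-> ->] := IH _ xs; rewrite !andbT /=.
have [_] := steps_bounds xs.
by apply: sub_all => p /andP[xp _]; rewrite /spaced /= xp.
Qed.

Lemma steps_length a s : \sum_(p <- steps a s) (p.2 - p.1) = last a s - a.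
Proof.
elim: s a => [|x s IH] a /=; first by rewrite big_nil subrr.
by rewrite big_cons IH /=; ring.
Qed.

Lemma steps_variation f a s : path <%R a s ->
  \sum_(p <- steps a s) `|f p.2 - f p.1| = variation a (last a s) f s.
Proof.
move=> pas; rewrite variation_zip; last by split.
elim: s a pas => [|x s IH] a /=; first by rewrite !big_nil.
by move=> /andP[_ /IH E]; rewrite !big_cons /= E.
Qed.

Lemma family_cat l1 l2 : increment_family (l1 ++ l2) =
  [&& increment_family l1, increment_family l2 & allrel spaced l1 l2].
Proof.
rewrite /increment_family all_cat pairwise_cat.
by case: (all _ l1); case: (all _ l2); case: (pairwise _ l1); case: (pairwise _ l2);
   case: (allrel _ _ _).
Qed.

(** Refining each interval of a family by a partition does not change its total
    length, so the modulus of absolute continuity also controls the supremum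
    over all refinements, that is the total variations. *)
Lemma total_variation_modulus f (e d : R) :
  (forall l, increment_family l ->
    \sum_(p <- l) (p.2 - p.1) < d -> \sum_(p <- l) `|f p.2 - f p.1| <= e) ->
  forall s l, increment_family (l ++ s) ->
    \sum_(p <- l ++ s) (p.2 - p.1) < d ->
    ((\sum_(p <- l) `|f p.2 - f p.1|)%:E + \sum_(p <- s) total_variation p.1 p.2 f
     <= e%:E)%E.
Proof.
move=> H; elim=> [|p s IH] l.
  by rewrite cats0 big_nil adde0 lee_fin; exact: H.
move=> fam; rewrite big_cat big_cons /= => lt_d.
have p12 : p.1 <= p.2.
  by move: fam; rewrite family_cat => /and3P[_ /andP[/= /andP[]]].
have fam_ls : increment_family (l ++ s).
  move: fam; rewrite !family_cat allrel_consr => /and3P[-> /andP[/= /andP[_ h1] /andP[_ h2]]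
    /andP[_ ->]].
  by rewrite /increment_family h1 h2.
have S0 : (0 <= \sum_(q <- s) total_variation q.1 q.2 f)%E.
  rewrite big_seq; apply: sume_ge0 => q qs; apply: total_variation_ge0.
  move: fam_ls; rewrite family_cat => /and3P[_ /andP[/allP/(_ _ qs)]] //.
have Sfin : (\sum_(q <- s) total_variation q.1 q.2 f)%E \is a fin_num.
  rewrite ge0_fin_numE //; apply: (@le_lt_trans _ _ e%:E); last exact: ltry.
  apply: le_trans (IH l fam_ls _).
    by rewrite leeDr // lee_fin sumr_ge0.
  by rewrite big_cat /=; lra.
rewrite big_cons -(fineK Sfin) addeCA -leeBrDr; last by rewrite -EFinD.
apply: ge_ereal_sup => _ [_ [t [pt /eqP pl] <-] <-].
rewrite leeBrDr; last by rewrite -EFinD.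
rewrite fineK // addeA -EFinD -pl -steps_variation //.
have -> : \sum_(q <- steps p.1 t) `|f q.2 - f q.1| + \sum_(q <- l) `|f q.2 - f q.1|
   = \sum_(q <- l ++ steps p.1 t) `|f q.2 - f q.1|.
  by rewrite big_cat /= addrC.
apply: IH; last first.
  by rewrite !big_cat /= steps_length pl; lra.
have [_ bnd] := steps_bounds pt.
have sub q : (spaced q p) -> all (spaced q) (steps p.1 t).
  move=> qp; apply: sub_all bnd => r /and3P[h1 h2 h3].
  move: qp; rewrite /spaced -pl => /orP[qp|qp].
    by rewrite (le_trans qp h1).
  by rewrite (le_trans h3 qp) orbT.
have symS q r : spaced q r = spaced r q by rewrite /spaced orbC.
rewrite -catA family_cat.
move: fam; rewrite family_cat allrel_consr => /and3P[-> /andP[/= /andP[_ h1] /andP[h2 h3]]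
  /andP[h4 h5]].
rewrite family_cat steps_family //= allrel_catr h5 /increment_family h1 h3 /= andbT.
apply/andP; split.
  by rewrite allrelC; apply/allrelP => q r qs rt; move/allP: h2 => /(_ _ qs);
     rewrite symS => /sub /allP/(_ _ rt); rewrite symS.
by apply/allrelP => q r ql rt; move/allP: h4 => /(_ _ ql) /sub /allP; exact.
Qed.

Lemma ac_total_variation f (e : R) : ac f -> 0 < e -> exists2 d : R, 0 < d &
  forall s, increment_family s -> \sum_(p <- s) (p.2 - p.1) < d ->
    (\sum_(p <- s) total_variation p.1 p.2 f <= e%:E)%E.
Proof.
move=> acf e0; have [d d0 H] := acf e e0; exists d => // s fs sd.
have := @total_variation_modulus f e d _ s [::] fs sd.
by rewrite big_nil add0e; apply => l fl ld; exact/ltW/H.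
Qed.

(** With [d] the modulus for [1], steps of length [d / 2] contribute at most [1]
    each, and finitely many of them exhaust [[a, b]]. *)
Lemma ac_bounded_variation f (a b : R) : ac f -> a <= b ->
  total_variation a b f \is a fin_num.
Proof.
move=> acf ab; have [d d0 H] := ac_total_variation acf (@ltr01 R).
have step x y : x <= y -> y - x < d -> (total_variation x y f <= 1)%E.
  move=> xy xyd; have := H [:: (x, y)].
  by rewrite !big_seq1 /increment_family /= xy; exact.
have K n : (total_variation a (a + n%:R * (d / 2)) f <= n%:R%:E)%E.
  elim: n => [|n IH]; first by rewrite mul0r addr0 total_variationxx.
  have le1 : a + n%:R * (d/2) <= a + n.+1%:R * (d/2).
    by rewrite lerD2l ler_pM2r ?ler_nat //; lra.
  rewrite (@total_variationD _ _ _ (a + n%:R * (d/2))) //; last first.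
    by rewrite lerDl mulr_ge0 //; lra.
  rewrite -[X in (_ <= X%:E)%E]natr1 EFinD leeD // step //.
  by rewrite -natr1; lra.
have [n nb] : exists n, b <= a + n%:R * (d / 2).
  exists (Num.bound ((b - a) / (d/2))).
  rewrite -lerBlDl -ler_pdivrMr; last by lra.
  by apply/ltW/archi_boundP; rewrite divr_ge0 //; lra.
rewrite ge0_fin_numE ?total_variation_ge0 //.
apply: le_lt_trans (_ : (_ <= n%:R%:E)%E) (ltry _).
apply: le_trans (K n).
by rewrite (total_variationD _ ab nb) leeDl // total_variation_ge0.
Qed.

End Variation.

(** * Stieltjes measures of absolutely continuous monotone functions *)

Section StieltjesDensity.
Context {R : realType}.
Implicit Types (f : R -> R) (l : seq (R * R)).
Local Notation lam := (@lebesgue_measure R).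

Lemma cvg_sqr (a : nat -> R) (b : R) : a n @[n --> \oo] --> b ->
  a n ^+ 2 @[n --> \oo] --> b ^+ 2.
Proof. by move=> ab; exact: (cvgM ab ab). Qed.

Lemma ac_continuous f : ac f -> continuous f.
Proof.
move=> acf x; apply/cvgrPdist_lt => e e0.
have [d d0 H] := acf e e0.
near=> y.
have : `|x - y| < d by near: y; exact: cvgr_dist_lt.
have [xy|/ltW yx] := leP x y.
  have := H [:: (x, y)]; rewrite !big_seq1 /increment_family /= xy => /(_ isT).
  by rewrite (distrC x) (distrC (f x)) => K; rewrite ger0_norm ?subr_ge0.
have := H [:: (y, x)]; rewrite !big_seq1 /increment_family /= yx => /(_ isT).
by move=> K; rewrite ger0_norm ?subr_ge0.
Unshelve. all: by end_near. Qed.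

Definition family_cover l : set R := \big[setU/set0]_(p <- l) `]p.1, p.2]%classic.

Lemma family_coverP l x :
  family_cover l x <-> exists2 p, p \in l & (p.1 < x) && (x <= p.2).
Proof.
rewrite /family_cover; elim: l => [|q l IH].
  by rewrite big_nil; split => [[]|[]].
rewrite big_cons; split.
  case=> [|/IH[p pl px]]; last by exists p => //; rewrite inE pl orbT.
  by rewrite /= in_itv /= => h; exists q; rewrite // inE eqxx.
case=> p; rewrite inE => /orP[/eqP-> px|pl px]; first by left; rewrite /= in_itv.
by right; apply/IH; exists p.
Qed.

Lemma measurable_family_cover l : measurable (family_cover l).
Proof. by rewrite /family_cover; apply: bigsetU_measurable => p _; exact: measurable_itv. Qed.

Lemma family_cover_disjoint p l : increment_family (p :: l) ->
  `]p.1, p.2]%classic `&` family_cover l = set0.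
Proof.
move=> /andP[_ /andP[sp _]].
apply/seteqP; split => // x [] /=; rewrite in_itv /= => /andP[px xp].
move=> /family_coverP[q ql /andP[qx xq]]; move/allP: sp => /(_ _ ql).
rewrite /spaced => /orP[] h.
  by have := le_lt_trans (le_trans xp h) qx; rewrite ltxx.
by have := le_lt_trans (le_trans xq h) px; rewrite ltxx.
Qed.

Lemma measure_family_cover (m : {measure set (measurableTypeR R) -> \bar R}) f l :
  (forall a b, a <= b -> m `]a, b]%classic = (f b - f a)%:E) ->
  increment_family l ->
  m (family_cover l) = (\sum_(p <- l) (f p.2 - f p.1))%:E.
Proof.
move=> mE; elim: l => [|p l IH]; first by rewrite /family_cover !big_nil measure0.
move=> /andP[/= /andP[p12 al] /andP[sp pw]].
have fl : increment_family l by apply/andP.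
rewrite big_cons EFinD -IH // -mE //.
rewrite /family_cover big_cons -/(family_cover l) measureU //.
- exact: measurable_family_cover.
- by apply: family_cover_disjoint; rewrite /increment_family /= p12 al sp.
Qed.

Lemma lebesgue_ocitv (a b : R) : a <= b -> lam `]a, b]%classic = (b - a)%:E.
Proof.
move=> ab; rewrite lebesgue_measure_itv /= lte_fin -EFinB; case: ltP => // ba.
by rewrite (le_anti (introT andP (conj ab ba))) subrr.
Qed.

Definition grid_point (n j : nat) : R := - n.+1%:R + j%:R / n.+1%:R.

(** Consecutive grid cells are disjoint by construction, so exhausting an open
    set by them avoids its decomposition into connected components. *)
Definition grid_cells (U : set R) (n : nat) : seq (R * R) :=
  [seq (grid_point n j, grid_point n j.+1) | j <-
    [seq j <- iota 0 (n.+1 * n.+1).*2 |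
       asbool (`]grid_point n j, grid_point n j.+1]%classic `<=` U)]].

Lemma grid_point_le n i j : (i <= j)%N -> grid_point n i <= grid_point n j.
Proof. by move=> ij; rewrite lerD2l ler_pM2r ?invr_gt0 ?ltr0n // ler_nat. Qed.

Lemma grid_cells_family U n : increment_family (grid_cells U n).
Proof.
apply/andP; split.
  by apply/allP => p /mapP[j _ ->] /=; exact: grid_point_le.
rewrite pairwise_map; apply: pairwise_filter.
have := iota_ltn_sorted 0 (n.+1 * n.+1).*2.
rewrite sorted_pairwise; last exact: ltn_trans.
apply: sub_pairwise => i j ij; rewrite /spaced /=.
by rewrite grid_point_le.
Qed.

Lemma grid_cells_sub U n : family_cover (grid_cells U n) `<=` U.
Proof.
move=> x /family_coverP[p /mapP[j]]; rewrite mem_filter => /andP[/asboolP jU _] ->.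
by move=> /= h; apply: jU; rewrite /= in_itv.
Qed.

Lemma near_infty_gtS (r : R) : \forall n \near \oo, r < n.+1%:R.
Proof.
apply: filterS (nbhs_infty_gtr r) => n /lt_trans; apply.
by rewrite ltr_nat.
Qed.

Lemma grid_cells_exhaust (U : set R) x : open U -> U x ->
  \forall n \near \oo, family_cover (grid_cells U n) x.
Proof.
move=> oU Ux.
have /nbhs_ballP[r /= r0 rU] : nbhs x U by exact: open_nbhs_nbhs.
near=> n.
have n0 : (0 : R) < n.+1%:R by rewrite ltr0n.
have nx : `|x| < n.+1%:R.
  by near: n; exact: near_infty_gtS.
have nr : n.+1%:R^-1 < r.
  rewrite -[r]invrK ltf_pV2 ?posrE ?invr_gt0 //.
  by near: n; exact: near_infty_gtS.
have /ltr_normlP[nx1 nx2] := nx.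
pose y := (x + n.+1%:R) * n.+1%:R.
have y0 : 0 < y by rewrite mulr_gt0 //; lra.
have exk : exists k, y <= k%:R.
  by exists (Num.bound y); apply/ltW/archi_boundP/ltW.
have kP := ex_minnP exk; move: kP => [[|k] yk kmin].
  by move: yk; rewrite leNgt y0.
have ky : k%:R < y by rewrite ltNge; apply/negP => /kmin; rewrite ltnn.
have E j : (grid_point n j < x) = (j%:R < y).
  by rewrite /grid_point /y -ltrBrDl opprK ltr_pdivrMr.
have E' j : (x <= grid_point n j) = (y <= j%:R).
  by rewrite !leNgt E.
apply/family_coverP; exists (grid_point n k, grid_point n k.+1); last first.
  by rewrite E E' ky yk.
apply/mapP; exists k => //; rewrite mem_filter mem_iota /= add0n; apply/andP; split.
  apply/asboolP => z /=; rewrite in_itv /= => /andP[z1 z2]; apply: rU.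
  rewrite /ball /=; have := E k; have := E' k.+1; rewrite ky yk => /idP x2 /idP x1.
  have w : grid_point n k.+1 - grid_point n k = n.+1%:R^-1.
    rewrite /grid_point -natr1; lra.
  move: nr w z1 z2 x1 x2; move: (grid_point n k) (grid_point n k.+1) (n.+1%:R^-1) => g1 g2 i *.
  by rewrite ltr_norml; apply/andP; split; lra.
rewrite -(ltr_nat R); apply: lt_le_trans ky _.
rewrite -mul2n !natrM /y mulrA ler_pM2r //; lra.
Unshelve. all: by end_near. Qed.

Section Cumulative.
Variable F : cumulative R R.
Local Notation nu := (lebesgue_stieltjes_measure F).

Lemma stieltjes_ocitv (a b : R) : a <= b -> nu `]a, b]%classic = (F b - F a)%:E.
Proof.
move=> ab; rewrite /lebesgue_stieltjes_measure /measure_extension/=.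
by rewrite measurable_mu_extE/= ?wlength_itv_bnd//; exact: is_ocitv.
Qed.

(** An open set is exhausted by finite families of grid cells, and on such a
    family the Stieltjes measure is the total increment of [F], small as soon
    as the total length is. *)
Lemma stieltjes_dominated : ac F -> nu `<< lam.
Proof.
move=> acF N nullN A mA AN; have lamA : lam A = 0 by exact: nullN.
apply/eqP; rewrite eq_le measure_ge0 andbT.
apply/lee_addgt0Pr => e e0; rewrite add0e.
have [d d0 H] := acF e e0.
have Aoo : (lam A < +oo)%E by rewrite lamA.
have [U [oU AU UA]] := lebesgue_regularity_outer mA Aoo d0.
have mU : measurable U by exact: open_measurable.
have lamU : (lam U < d%:E)%E.
  apply: le_lt_trans UA; rewrite -[U in leLHS](setDUK AU).
  rewrite (le_trans (measureU2 _ _ _)) //; first exact: measurableD.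
  by rewrite /= lamA add0e.
have nuF n : (nu (family_cover (grid_cells U n)) <= e%:E)%E.
  rewrite (measure_family_cover stieltjes_ocitv) ?grid_cells_family // lee_fin.
  apply: le_trans (ler_norm _) _; apply: le_trans (ler_norm_sum _ _ _) _.
  apply/ltW/H; first exact: grid_cells_family.
  rewrite -lte_fin; apply: le_lt_trans lamU.
  rewrite -(measure_family_cover (m := lam) (f := id)) ?grid_cells_family //.
    rewrite le_measure ?inE //; first exact: measurable_family_cover.
    exact: grid_cells_sub.
  by move=> a b; exact: lebesgue_ocitv.
pose G n := \bigcap_(k in [set k | (n <= k)%N]) family_cover (grid_cells U k).
have mG n : measurable (G n).
  by apply: bigcap_measurableType => *; exact: measurable_family_cover.
have UG : U `<=` \bigcup_n G n.
  move=> x Ux; have [n _ nP] := grid_cells_exhaust oU Ux.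
  by exists n => // k /=; exact: nP.
have cG : nu \o G @ \oo --> nu (\bigcup_n G n).
  apply: nondecreasing_cvg_mu => //; first by apply: bigcup_measurable => *; exact: mG.
  by apply/nondecreasing_seqP => n; apply/subsetPset => x h k /= nk; apply: h; exact: ltnW.
apply: le_trans (_ : (nu A <= nu (\bigcup_n G n))%E) _.
  rewrite le_measure ?inE //; first by apply: bigcup_measurable => *; exact: mG.
  exact: subset_trans UG.
rewrite -(cvg_lim _ cG) //; apply: lime_le; first by apply/cvg_ex; eexists; exact: cG.
near=> n; apply: le_trans (nuF n).
rewrite /=; apply: le_measure; rewrite ?inE //=; first exact: mG;
  first exact: measurable_family_cover.
by move=> x; apply => /=.
Unshelve. all: by end_near. Qed.

End Cumulative.

(** Radon-Nikodym theorem for the Stieltjes measure of [f], which is restricted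
    to [`]a, b]] in order to be finite. *)
Lemma monotone_ac_density f (a b : R) : {homo f : x y / x <= y} -> ac f ->
  a <= b -> exists phi : R -> R, lam.-integrable [set: R] (EFin \o phi) /\
   forall s t, a <= s -> s <= t -> t <= b ->
     (f t - f s)%:E = (\int[lam]_(x in `]s, t]) (phi x)%:E)%E.
Proof.
move=> ndf acf ab.
have rc : right_continuous f.
  move=> x; apply: cvg_at_right_filter; exact: ac_continuous.
pose Fm := isCumulative.Build R _ R f ndf rc.
pose F : cumulative R R := HB.pack f Fm.
have acF : ac F by [].
have mab : measurable (`]a, b]%classic : set (measurableTypeR R)) by exact: measurable_itv.
have fab : (lebesgue_stieltjes_measure F `]a, b]%classic < +oo)%E.
  by rewrite stieltjes_ocitv // ltry.
pose nu := mfrestr mab fab.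
have dom : nu `<< lam.
  move=> N nN A mA AN; rewrite /nu /mfrestr /mrestr.
  apply: (stieltjes_dominated acF nN); first exact: measurableI.
  by move=> x [/AN].
have [phi [phi0 phif iphi phiE]] := radon_nikodym_sigma_finite dom.
exists (fine \o phi); split.
  apply: eq_integrable iphi => // x _ /=.
  by rewrite fineK.
move=> s t as_ st tb.
have -> : (f t - f s)%:E = nu `]s, t]%classic.
  rewrite /nu /mfrestr /mrestr setIidl ?stieltjes_ocitv // => x /=.
  rewrite !in_itv /= => /andP[h1 h2].
  by rewrite (le_lt_trans as_ h1) (le_trans h2 tb).
rewrite [LHS]phiE; last exact: measurable_itv.
by apply: eq_integral => x _ /=; rewrite fineK.
Qed.

End StieltjesDensity.

(** * Difference quotients and absolute continuity on intervals *)

Section DifferenceQuotients.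
Context {R : realType}.
Implicit Types (f g : R -> R) (l : seq (R * R)).
Local Notation lam := (@lebesgue_measure R).

Definition slope f (x h : R) : R := h^-1 * (f (h + x) - f x).

Lemma derive1_lim_slope f x : derive1 f x = lim (slope f x h @[h --> 0^']).
Proof. by []. Qed.

Lemma derivable_slope f x : derivable f x 1 <-> cvg (slope f x h @[h --> 0^']).
Proof.
have <- : (fun h : R => h^-1 *: ((f \o shift x) (h *: 1) - f x)) = slope f x.
  by apply/funext => h; rewrite /slope /= [h *: 1]mulr1.
by [].
Qed.

Lemma derivable_slope_seq f x : derivable f x 1 ->
  slope f x n.+1%:R^-1 @[n --> \oo] --> derive1 f x.
Proof.
move=> /derivable_slope df; rewrite derive1_lim_slope.
apply: (cvg_comp _ _ _ df).
move=> A /= /nbhs_ballP[e /= e0 eA].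
near=> n; apply: eA => /=; last by rewrite invr_eq0 pnatr_eq0.
rewrite /ball /= sub0r normrN gtr0_norm ?invr_gt0 ?ltr0n //.
rewrite -[e]invrK ltf_pV2 ?posrE ?invr_gt0 ?ltr0n //.
by near: n; exact: near_infty_gtS.
Unshelve. all: by end_near. Qed.

Lemma derivable_add f g x : derivable f x 1 -> derivable g x 1 ->
  derivable (fun y => f y + g y) x 1 /\
  derive1 (fun y => f y + g y) x = derive1 f x + derive1 g x.
Proof.
move=> df dg; split; first exact: (@derivableD R R R f g x 1 df dg).
rewrite (@derive1E R R (fun y => f y + g y)) (@derive1E R R f) (@derive1E R R g).
exact: (@deriveD R R R f g x 1 df dg).
Qed.

Lemma derivable_shift f (c x : R) : derivable f x 1 ->
  derivable (fun y => f y + c) x 1 /\ derive1 (fun y => f y + c) x = derive1 f x.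
Proof.
move=> df; have [d E] := derivable_add df (derivable_cst c x 1).
split; first exact: d.
by rewrite E (@derive1E R R (fun=> c)) (@derive_cst R R R c x 1) addr0.
Qed.

Lemma derivable_scale f (c x : R) : derivable f x 1 ->
  derivable (fun y => c * f y) x 1 /\
  derive1 (fun y => c * f y) x = c * derive1 f x.
Proof.
move=> df; split; first exact: (@derivableZ R R R f c x 1 df).
rewrite (@derive1E R R (fun y => c * f y)) (@derive1E R R f).
exact: (@deriveZ R R R f c x 1 df).
Qed.

Lemma derivable_sqr f x : derivable f x 1 ->
  derivable (fun y => f y ^+ 2) x 1 /\
  derive1 (fun y => f y ^+ 2) x = 2 * f x * derive1 f x.
Proof.
move=> df; split; first exact: (@derivableX R R f 2 x 1 df).
rewrite (@derive1E R R (fun y => f y ^+ 2)) (@derive1E R R f).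
exact: (@deriveX R R f 2 x 1 df).
Qed.

Lemma derivable_near f g x : derivable f x 1 -> {near x, f =1 g} ->
  derivable g x 1 /\ derive1 g x = derive1 f x.
Proof.
move=> df fg; split; first exact: (@near_eq_derivable R R R f g x 1 fg df).
rewrite (@derive1E R R f) (@derive1E R R g).
exact/esym/(@near_eq_derive R R R f g x 1).
Qed.

Lemma derive1_near0 f x : {near x, f =1 fun=> 0} -> derive1 f x = 0.
Proof.
move=> f0; rewrite (@derive1E R R f) (@near_eq_derive R R R f (fun=> 0) x 1 f0).
exact: (@derive_cst R R R 0 x 1).
Qed.

(** For continuous [f] these sets are closed, and the Cauchy criterion for the
    difference quotients writes the set of differentiability points as a
    countable combination of them. *)
Definition slope_osc f (k n : nat) : set R :=
  [set x | forall h, 0 < `|h| < n.+1%:R^-1 -> forall h', 0 < `|h'| < n.+1%:R^-1 ->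
     `|slope f x h - slope f x h'| <= k.+1%:R^-1].

Lemma near_dnbhs0 (P : R -> Prop) : (\forall h \near 0^', P h) <->
  exists n : nat, forall h : R, 0 < `|h| < n.+1%:R^-1 -> P h.
Proof.
split.
  move=> /nbhs_ballP[e /= e0 eP]; near \oo => n.
  exists n => h /andP[h0 hn]; apply: eP; last by rewrite -normr_gt0.
  rewrite /ball /= sub0r normrN (lt_trans hn) //.
  rewrite -[e]invrK ltf_pV2 ?posrE ?invr_gt0 ?ltr0n //.
  by near: n; exact: near_infty_gtS.
move=> [n nP]; apply/nbhs_ballP; exists n.+1%:R^-1 => /=; first by rewrite invr_gt0 ltr0n.
move=> h; rewrite /ball /= sub0r normrN => hn h0; apply: nP.
by rewrite normr_gt0 h0.
Unshelve. all: by end_near. Qed.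

Lemma derivable_osc f x : derivable f x 1 <->
  (\bigcap_k \bigcup_n slope_osc f k n) x.
Proof.
rewrite derivable_slope; split.
  move=> /cvg_ex[l /cvgrPdist_lt H] k _.
  have /H/near_dnbhs0[n nP] : (0 : R) < k.+1%:R^-1 / 2 by rewrite divr_gt0 ?invr_gt0 ?ltr0n.
  exists n => // h /nP h1 h' /nP h2.
  rewrite (_ : _ - _ = (l - slope f x h') - (l - slope f x h)); last by ring.
  apply: le_trans (ler_normB _ _) _.
  by apply: le_trans (lerD (ltW h2) (ltW h1)) _; rewrite -splitr.
move=> H; apply/cauchy_cvgP/cauchy_ballP => e e0.
near \oo => k.
have ke : k.+1%:R^-1 < e.
  rewrite -[e]invrK ltf_pV2 ?posrE ?invr_gt0 ?ltr0n //.
  by near: k; exact: near_infty_gtS.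
have [n _ nP] := H k I.
pose A := [set y | exists2 h, 0 < `|h| < n.+1%:R^-1 & y = slope f x h].
exists (A, A) => /=.
  by split; apply/near_dnbhs0; exists n => h hn; exists h.
move=> [_ _] /= [[h hn ->] [h' h'n ->]]; rewrite /ball /=.
by apply: le_lt_trans ke; exact: nP.
Unshelve. all: by end_near. Qed.

Lemma measurable_derivable f : continuous f -> measurable [set x | derivable f x 1].
Proof.
move=> cf; rewrite (_ : [set x | _] = \bigcap_k \bigcup_n slope_osc f k n); last first.
  by apply/seteqP; split => x /derivable_osc.
apply: bigcapT_measurable => k; apply: bigcupT_measurable => n.
apply: closed_measurable.
rewrite (_ : slope_osc _ _ _ = \bigcap_(h in [set h | 0 < `|h| < n.+1%:R^-1])
   \bigcap_(h' in [set h' | 0 < `|h'| < n.+1%:R^-1])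
    ((fun x => `|slope f x h - slope f x h'|) @^-1` [set y | y <= k.+1%:R^-1])); last first.
  by apply/seteqP; split.
apply: closed_bigI => h _; apply: closed_bigI => h' _.
apply: closed_comp; last exact: closed_le.
have cs c : continuous (fun x => slope f x c).
  move=> x; apply: cvgMr; apply: cvgB; last exact: cf.
  apply: continuous_comp; last exact: cf.
  by apply: cvgD; [exact: cvg_cst|exact: cvg_id].
by move=> x _; apply: cvg_norm; apply: cvgB; exact: cs.
Qed.

(** Where [f] is not differentiable the limit defining [derive1 f x] is the
    default point, so there the function is constant. *)
Lemma measurable_derive1 f : continuous f -> measurable_fun setT (derive1 f).
Proof.
move=> cf; set D := [set x | derivable f x 1].
have mD : measurable D by exact: measurable_derivable.
rewrite -(setUv D); apply/measurable_funU => //; first exact: measurableC.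
split.
  apply: (@measurable_fun_cvg _ _ _ D (fun n x => slope f x n.+1%:R^-1)).
    move=> n; apply: measurable_funM => //; apply: measurable_funB.
      apply: measurable_funTS; apply: measurableT_comp.
        exact: continuous_measurable_fun.
      exact: measurable_funD.
    apply: measurable_funTS; exact: continuous_measurable_fun.
  by move=> x; exact: derivable_slope_seq.
have [y yP] : exists y : R, forall x, (~` D) x -> derive1 f x = y.
  exists point => x /= nD; rewrite derive1_lim_slope; apply: dvgP.
  by move=> c; apply: nD; apply/derivable_slope.
apply: (@eq_measurable_fun _ _ _ _ _ (cst y)) => // x; rewrite inE => /yP.
by [].
Qed.

Definition clamp (a b x : R) : R := if x < a then a else if b < x then b else x.

(** Absolute continuity on [[a, b]] is that of the function extended by constants
    outside; this keeps [ac] a notion about functions on the whole line. *)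
Definition lac f := forall a b, a < b -> ac (f \o clamp a b).

Section Clamp.
Variables a b : R.
Hypothesis ab : a <= b.

Lemma clamp_le x y : x <= y -> clamp a b x <= clamp a b y.
Proof.
by rewrite /clamp; case: (ltP x a); case: (ltP b x); case: (ltP y a);
  case: (ltP b y) => * /=; try lra.
Qed.

Lemma clamp_lip x y : x <= y -> clamp a b y - clamp a b x <= y - x.
Proof.
by rewrite /clamp; case: (ltP x a); case: (ltP b x); case: (ltP y a);
  case: (ltP b y) => * /=; try lra.
Qed.

Lemma clamp_itv x : a <= clamp a b x <= b.
Proof.
by rewrite /clamp; case: (ltP x a); case: (ltP b x) => * /=; apply/andP; split; try lra.
Qed.

Lemma clamp_id x : a <= x -> x <= b -> clamp a b x = x.
Proof. by rewrite /clamp !leNgt => /negbTE -> /negbTE ->. Qed.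

End Clamp.

Definition map_family (c : R -> R) l := [seq (c p.1, c p.2) | p <- l].

Lemma map_family_contraction (c : R -> R) l :
  (forall x y, x <= y -> c x <= c y) -> (forall x y, x <= y -> c y - c x <= y - x) ->
  increment_family l ->
  increment_family (map_family c l) /\
  \sum_(p <- map_family c l) (p.2 - p.1) <= \sum_(p <- l) (p.2 - p.1).
Proof.
move=> mono lip /andP[al pw]; split; last first.
  rewrite big_map big_seq [leRHS]big_seq; apply: ler_sum => p pl /=.
  by apply: lip; exact: (allP al).
apply/andP; split.
  by rewrite all_map; apply: sub_all al => p /=; exact: mono.
rewrite pairwise_map; apply: sub_pairwise pw => p q; rewrite /spaced /=.
by move=> /orP[] /mono ->; rewrite ?orbT.
Qed.

Lemma map_family_clamp a b l : a <= b -> increment_family l ->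
  increment_family (map_family (clamp a b) l) /\
  \sum_(p <- map_family (clamp a b) l) (p.2 - p.1) <= \sum_(p <- l) (p.2 - p.1).
Proof.
by move=> ab; apply: map_family_contraction => x y; [exact: clamp_le|exact: clamp_lip].
Qed.

Lemma ac_clamp f a b : a <= b -> ac f -> ac (f \o clamp a b).
Proof.
move=> ab acf e /acf[d d0 H]; exists d => // l /(map_family_clamp ab)[fl lel] ld.
by have := H _ fl (le_lt_trans lel ld); rewrite big_map.
Qed.

Lemma ac_le f g1 g2 : ac g1 -> ac g2 ->
  (forall x y, x <= y -> `|f y - f x| <= `|g1 y - g1 x| + `|g2 y - g2 x|) -> ac f.
Proof.
move=> ac1 ac2 H e e0; have e20 : 0 < e / 2 by rewrite divr_gt0.
have [d1 d10 H1] := ac1 _ e20; have [d2 d20 H2] := ac2 _ e20.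
exists (Num.min d1 d2); first by rewrite lt_min d10.
move=> l fl; rewrite lt_min => /andP[/(H1 _ fl) l1 /(H2 _ fl) l2].
rewrite [e]splitr; apply: le_lt_trans (ltrD l1 l2); rewrite -big_split /=.
rewrite big_seq [leRHS]big_seq; apply: ler_sum => p pl; apply: H.
by case/andP: fl => /allP/(_ _ pl).
Qed.

Section Monotone.
Variables (f : R -> R) (a b : R).
Hypotheses (acf : ac f) (ab : a <= b).

Definition variation_fun (x : R) : R := fine (total_variation a (clamp a b x) f).

Lemma variation_funB x y : x <= y ->
  (variation_fun y - variation_fun x)%:E =
  total_variation (clamp a b x) (clamp a b y) f.
Proof.
move=> /(clamp_le ab) xy; have /andP[ax _] := clamp_itv ab x.
rewrite /variation_fun [X in (fine X - _)%:E](total_variationD _ ax xy).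
rewrite fineD ?ac_bounded_variation // addrAC subrr add0r fineK //.
exact: ac_bounded_variation.
Qed.

Lemma variation_fun_ge x y : x <= y ->
  `|f (clamp a b y) - f (clamp a b x)| <= variation_fun y - variation_fun x.
Proof.
move=> xy; rewrite -lee_fin variation_funB //.
by apply: total_variation_ge; exact: clamp_le.
Qed.

Lemma variation_fun_le x y : x <= y -> variation_fun x <= variation_fun y.
Proof. by move=> xy; rewrite -subr_ge0 (le_trans _ (variation_fun_ge xy)). Qed.

Lemma ac_variation_fun : ac variation_fun.
Proof.
move=> e e0; have e20 : 0 < e / 2 by rewrite divr_gt0.
have [d d0 H] := ac_total_variation acf e20.
exists d => // l fl ld; have [fc lc] := map_family_clamp ab fl.
have := H _ fc (le_lt_trans lc ld); rewrite big_map /=.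
move=> h; apply: (@le_lt_trans _ _ (e / 2)); last by lra.
rewrite -lee_fin; apply: le_trans h.
rewrite -sumEFin big_seq [leRHS]big_seq; apply: lee_sum => p pl.
have p12 : p.1 <= p.2 by case/andP: fl => /allP/(_ _ pl).
by rewrite ger0_norm ?subr_ge0 ?variation_fun_le // variation_funB.
Qed.

End Monotone.

End DifferenceQuotients.

(** * The fundamental theorem of calculus *)

Section LocalAbsoluteContinuity.
Context {R : realType}.
Implicit Types (f : R -> R).
Local Notation lam := (@lebesgue_measure R).

Lemma ae_imp (P Q : R -> Prop) : (forall x, P x -> Q x) ->
  {ae lam, forall x, P x} -> {ae lam, forall x, Q x}.
Proof. by move=> PQ; apply: filterS => //; exact: (ae_filter_ringOfSetsType lam). Qed.

Lemma ae_imp2 (P1 P2 Q : R -> Prop) : (forall x, P1 x -> P2 x -> Q x) ->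
  {ae lam, forall x, P1 x} -> {ae lam, forall x, P2 x} -> {ae lam, forall x, Q x}.
Proof.
by move=> PQ; apply: filterS2 => //; exact: (ae_filter_ringOfSetsType lam).
Qed.

Lemma ae_eq_integrable (D : set R) (f g : R -> \bar R) : measurable D ->
  measurable_fun D g -> ae_eq lam D f g -> lam.-integrable D f -> lam.-integrable D g.
Proof.
move=> mD mg fg /integrableP[mf fi]; apply/integrableP; split => //.
rewrite (@ae_eq_integral _ _ _ lam D (abse \o f)) //.
- exact: measurableT_comp.
- exact: measurableT_comp.
- by apply: ae_eq_sym; exact: ae_eq_abse.
Qed.

(** On [[a, b]], [f] is the difference of its variation function and of the
    variation function minus [f]. Both are monotone and absolutely continuous,
    hence integrals of densities, and Lebesgue's differentiation theorem
    identifies the difference of the densities with the derivative. *)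
Lemma ac_ftc_itv f (a b : R) : a < b -> ac f -> exists phi : R -> R,
  [/\ lam.-integrable [set: R] (EFin \o phi),
      forall s t, a <= s -> s <= t -> t <= b ->
        f t - f s = \int[lam]_(x in `[s, t]) phi x &
      {ae lam, forall x, a < x < b -> derivable f x 1 /\ derive1 f x = phi x}].
Proof.
move=> ab acf; have leab := ltW ab.
pose F := variation_fun f a b; pose G x := F x - f (clamp a b x).
have acF : ac F by exact: ac_variation_fun.
have ndF : {homo F : x y / x <= y} by move=> x y; exact: variation_fun_le.
have acG : ac G.
  apply: (ac_le acF (ac_clamp leab acf)) => x y xy.
  rewrite /G (_ : _ - _ - _ = (F y - F x) - (f (clamp a b y) - f (clamp a b x))); last by ring.
  exact: ler_normB.
have ndG : {homo G : x y / x <= y}.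
  move=> x y xy; rewrite -subr_ge0 /G.
  rewrite (_ : _ - _ - _ = (F y - F x) - (f (clamp a b y) - f (clamp a b x))); last by ring.
  by rewrite subr_ge0; apply: le_trans (ler_norm _) _; exact: variation_fun_ge.
have [p1 [ip1 p1E]] := monotone_ac_density ndF acF leab.
have [p2 [ip2 p2E]] := monotone_ac_density ndG acG leab.
pose phi x := p1 x - p2 x.
have iphi : lam.-integrable [set: R] (EFin \o phi).
  by rewrite (_ : _ \o _ = (EFin \o p1) \- (EFin \o p2))%E //; exact: integrableB.
have phiE s t : a <= s -> s <= t -> t <= b -> f t - f s = \int[lam]_(x in `[s, t]) phi x.
  move=> as_ st tb.
  have mst : measurable `]s, t]%classic by exact: measurable_itv.
  rewrite -Rintegral_itv_obnd_cbnd; last exact: integrableS iphi.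
  rewrite RintegralB //; [|exact: integrableS ip1|exact: integrableS ip2].
  have -> : \int[lam]_(x in `]s, t]) p1 x = F t - F s by rewrite /Rintegral -p1E.
  have -> : \int[lam]_(x in `]s, t]) p2 x = G t - G s by rewrite /Rintegral -p2E.
  rewrite /G !clamp_id //; [ring|exact: le_trans tb|exact: le_trans st].
exists phi; split => //.
have locphi : locally_integrable [set: R] phi.
  have := @integrable_locally _ phi setT measurableT iphi.
  by rewrite patch_setT.
have iy y : lam.-integrable [set` Interval (BLeft a) (BRight y)] (EFin \o phi).
  exact: integrableS iphi.
have := FTC1 iy locphi.
apply: ae_imp => x /= + /andP[ax xb] => /(_ _)[]; first by rewrite lte_fin.
set J := fun _ => _ => dJ J'.
have JE : {near x, (fun y => J y + f a) =1 f}.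
  near=> y.
  have /andP[ay yb] : (a < y) && (y < b).
    apply/andP; split; near: y; [exact: lt_nbhsr|exact: lt_nbhsl].
  by rewrite /J -phiE ?(ltW ay) ?(ltW yb) ?lexx // subrK.
have [dJa EJ] := derivable_shift (f a) dJ.
have [df ->] := derivable_near dJa JE.
by rewrite EJ.
Unshelve. all: by end_near. Qed.

Lemma clamp_near f (a b x : R) : a < x < b -> {near x, (f \o clamp a b) =1 f}.
Proof.
move=> /andP[ax xb]; near=> y; rewrite /= clamp_id //; near: y.
  by apply: filterS (lt_nbhsr ax) => y; exact: ltW.
by apply: filterS (lt_nbhsl xb) => y; exact: ltW.
Unshelve. all: by end_near. Qed.

Lemma lac_continuous f : lac f -> continuous f.
Proof.
move=> lf x.
have x1 : x - 1 < x + 1 by lra.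
have xx : x - 1 < x < x + 1 by lra.
have /ac_continuous/(_ x) := lf _ _ x1.
rewrite /continuous_at /= [in X in _ --> X -> _]clamp_id; [|lra|lra].
apply: cvg_trans; apply: near_eq_cvg.
by have := clamp_near f xx; apply: filterS.
Qed.

Lemma lac_ftc_ae f : lac f -> forall a b, a < b -> exists phi : R -> R,
  [/\ lam.-integrable [set: R] (EFin \o phi),
      forall s t, a <= s -> s <= t -> t <= b ->
        f t - f s = \int[lam]_(x in `[s, t]) phi x &
      {ae lam, forall x, a < x < b -> derivable f x 1 /\ derive1 f x = phi x}].
Proof.
move=> lf a b ab; have [phi [iphi phiE aeP]] := ac_ftc_itv ab (lf _ _ ab).
exists phi; split => //.
  move=> s t as_ st tb; rewrite -phiE //= !clamp_id //; lra.
apply: ae_imp aeP => x /= H /[dup] abx /H[df <-].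
exact: derivable_near df (clamp_near f abx).
Qed.

Lemma lac_derivable f : lac f -> {ae lam, forall x, derivable f x 1}.
Proof.
move=> lf.
have H n : {ae lam, forall x, - n.+1%:R < x < n.+1%:R -> derivable f x 1}.
  have n1 : (- n.+1%:R : R) < n.+1%:R by rewrite gtrN ?ltr0n.
  have [phi [_ _]] := lac_ftc_ae lf n1.
  by apply: ae_imp => x H /H[].
have := ae_foralln H.
apply: ae_imp => x /= {}H.
have [n nx] : exists n : nat, `|x| < n.+1%:R.
  by near \oo => n; exists n; near: n; exact: near_infty_gtS.
by apply: (H n); rewrite -ltr_norml.
Unshelve. all: by end_near. Qed.

(** The density of [ac_ftc_itv] depends on the interval, but it agrees almost
    everywhere with [derive1 f], which does not. *)
Lemma lac_ftc f : lac f -> forall s t, s <= t ->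
  lam.-integrable `[s, t] (EFin \o derive1 f) /\
  f t - f s = \int[lam]_(x in `[s, t]) derive1 f x.
Proof.
move=> lf s t st.
have st1 : s - 1 < t + 1 by lra.
have [phi [iphi phiE aeP]] := lac_ftc_ae lf st1.
have mst : measurable (`[s, t]%classic : set R) by exact: measurable_itv.
have mf' : measurable_fun `[s, t]%classic (EFin \o derive1 f).
  apply/measurable_EFinP; apply: measurable_funTS.
  by apply: measurable_derive1; exact: lac_continuous.
have iphi' : lam.-integrable `[s, t] (EFin \o phi) by exact: integrableS iphi.
have ae : ae_eq lam `[s, t]%classic (EFin \o phi) (EFin \o derive1 f).
  apply: ae_imp aeP => x H /=; rewrite in_itv /= => /andP[sx xt].
  have : s - 1 < x < t + 1 by apply/andP; split; lra.
  by move=> /H[_ ->].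
split; first exact: ae_eq_integrable iphi'.
rewrite phiE //; [|lra|lra].
rewrite /Rintegral; congr fine; apply: ae_eq_integral => //.
exact: measurable_int iphi'.
Qed.

End LocalAbsoluteContinuity.

(** * Absolute continuity of complex functions *)

Section AbsContOn.
Context {R : realType}.
Implicit Types (f : R -> R[i]) (w : R -> R) (l : seq (R * R)).

Lemma spaced_sym (p q : R * R) : spaced p q = spaced q p.
Proof. by rewrite /spaced orbC. Qed.

Lemma cmod_ge0 (z : R[i]) : 0 <= cmod z.
Proof. exact: sqrtr_ge0. Qed.

(** Clamping a family to [[a, b]] may produce degenerate intervals, which
    [abs_cont_on] excludes; they do not contribute to the increments of [w] and
    are filtered out. *)
Lemma lac_of_abs_cont_on f w : (forall a b, a <= b -> abs_cont_on a b f) ->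
  (forall x y, `|w y - w x| <= cmod (f y - f x)) -> lac w.
Proof.
move=> acf wf a b ab e e0; have [d d0 H] := acf a b (ltW ab) e e0.
exists d => // l /(map_family_clamp (ltW ab))[fl len] ld.
pose l' := [seq p <- map_family (clamp a b) l | p.1 < p.2].
have al' : all (fun p => [&& a <= p.1, p.1 < p.2 & p.2 <= b]) l'.
  apply/allP => p; rewrite mem_filter => /andP[-> /mapP[q _ ->]] /=.
  by have /andP[-> _] := clamp_itv (ltW ab) q.1; have /andP[_ ->] := clamp_itv (ltW ab) q.2.
have pw' : pairwise spaced l' by case/andP: fl => _; exact: pairwise_filter.
pose s (i : 'I_(size l')) := (nth (0, 0) l' i).1.
pose t (i : 'I_(size l')) := (nth (0, 0) l' i).2.
have sumE (G : R * R -> R) : \sum_(i < size l') G (nth (0, 0) l' i) = \sum_(p <- l') G p.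
  by rewrite [RHS](big_nth (0, 0)) big_mkord.
have sum_l' (G : R * R -> R) : (forall p, p.1 = p.2 -> G p = 0) ->
    \sum_(p <- l') G p = \sum_(p <- map_family (clamp a b) l) G p.
  move=> G0; rewrite big_filter [RHS](bigID (fun p => p.1 < p.2)) /=.
  rewrite [X in _ + X]big1_seq ?addr0 // => p /andP[p12 pl]; apply: G0.
  apply/le_anti; rewrite [p.2 <= _]leNgt p12 andbT.
  by case/andP: fl => /allP/(_ _ pl).
have Hst i : [/\ a <= s i, s i < t i & t i <= b].
  by move/allP: al' => /(_ _ (mem_nth (0, 0) (ltn_ord i)))/and3P.
have disj i j : i != j -> t i <= s j \/ t j <= s i.
  move=> ij; apply/orP; rewrite -/(spaced (nth (0, 0) l' i) (nth (0, 0) l' j)).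
  move/(pairwiseP (0, 0)): pw' => pw'.
  have [ltij|ltji|eqij] := ltngtP (i : nat) j.
  - by apply: pw' => //; rewrite inE.
  - by rewrite spaced_sym; apply: pw' => //; rewrite inE.
  - by move/eqP: ij => []; exact: val_inj.
have := H _ s t Hst disj.
rewrite (sumE (fun p => p.2 - p.1)) (sumE (fun p => cmod (f p.2 - f p.1))).
rewrite (sum_l' (fun p => p.2 - p.1)); last by move=> p ->; rewrite subrr.
move=> /(_ (le_lt_trans len ld)); apply: le_lt_trans.
rewrite (_ : \sum_(p <- l) _ = \sum_(p <- map_family (clamp a b) l) `|w p.2 - w p.1|).
  by rewrite -sum_l' ?ler_sum // => p ->; rewrite subrr normr0.
by rewrite big_map.
Qed.

Lemma cmod_real (x : R) : cmod x%:C = `|x|.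
Proof. by rewrite /cmod /= expr0n addr0 sqrtr_sqr. Qed.

Lemma abs_cont_on_of_ac w a b : ac w -> abs_cont_on a b (fun x => (w x)%:C).
Proof.
move=> acw e e0; have [d d0 H] := acw e e0; exists d => // n s t st disj len.
have := H [seq (s i, t i) | i <- index_enum 'I_n]; rewrite !big_map /=.
have -> : \sum_(i < n) cmod ((w (t i))%:C - (w (s i))%:C) = \sum_(i < n) `|w (t i) - w (s i)|.
  by apply: eq_bigr => i _; rewrite -rmorphB /= cmod_real.
apply => //; apply/andP; split.
  by apply/allP => _ /mapP[i _ ->] /=; have [_ /ltW] := st i.
rewrite pairwise_map.
have := index_enum_uniq 'I_n; rewrite uniq_pairwise; apply: sub_pairwise => i j /= /disj /orP.
by rewrite /spaced.
Qed.

Lemma ac_lip w g (K : R) : 0 <= K -> ac g ->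
  (forall x y, `|w y - w x| <= K * `|g y - g x|) -> ac w.
Proof.
move=> K0 acg H e e0.
have K1 : 0 < K + 1 by lra.
have [d d0 Hd] := acg (e / (K + 1)) (divr_gt0 e0 K1).
exists d => // l fl /(Hd _ fl); rewrite ltr_pdivlMr // mulrC.
apply: le_lt_trans; rewrite mulr_sumr; apply: ler_sum => p _.
by apply: le_trans (H _ _) _; rewrite ler_wpM2r // lerDl.
Qed.

(** Absolute continuity of [w] on [[a, b]] bounds [w] there, by its total
    variation, and squaring is Lipschitz on bounded sets. *)
Lemma lac_sq w : lac w -> lac (fun x => w x ^+ 2).
Proof.
move=> lw a b ab; have acw := lw a b ab; have leab := ltW ab.
pose V := variation_fun (w \o clamp a b) a b.
pose M := `|w a| + V b.
have bnd x : `|w (clamp a b x)| <= M.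
  have /andP[ac cb] := clamp_itv leab x.
  have := variation_fun_ge acw leab ac; rewrite /= !(@clamp_id _ a b a) // ?lexx //.
  move=> h.
  have mon := variation_fun_le acw leab cb.
  have V0 : 0 <= V a by rewrite fine_ge0 // total_variation_ge0 // clamp_id ?lexx.
  have := ler_normD (w (clamp a b x) - w a) (w a); rewrite subrK.
  move: h mon V0; rewrite -/V /M !(@clamp_id _ a b (clamp a b x)) //; lra.
have M0 : 0 <= M by apply: le_trans (bnd 0); exact: normr_ge0.
apply: (ac_lip (K := 2 * M) _ acw); first by rewrite mulr_ge0.
move=> x y /=; rewrite subr_sqr normrM mulrC ler_wpM2r //.
apply: le_trans (ler_normD _ _) _.
by have := bnd x; have := bnd y; lra.
Qed.

End AbsContOn.

(** * Integration on the half-line *)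

Section HalfLine.
Context {R : realType}.
Implicit Types (f g w : R -> R).
Local Notation lam := (@lebesgue_measure R).

Definition posR : set R := `]0%R, +oo[%classic.

Lemma measurable_posR : measurable posR.
Proof. exact: measurable_itv. Qed.

(** The Borel sets of [R] are displayed in two convertible ways; integrals with
    respect to [lebesgue_measure] produce this one. *)
Lemma measurable_posR_sigma : measurable (posR : set (measurableTypeR R)).
Proof. exact: measurable_posR. Qed.
#[local] Hint Resolve measurable_posR measurable_posR_sigma : core.

Lemma posRE x : posR x = (0 < x) :> Prop.
Proof. by rewrite /posR /= in_itv /= andbT. Qed.

Definition sq_int f :=
  measurable_fun posR f /\ lam.-integrable posR (EFin \o (fun x => f x ^+ 2)).

Lemma le_integrable_real (A : set R) f g : measurable A -> measurable_fun A f ->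
  (forall x, A x -> `|f x| <= g x) -> lam.-integrable A (EFin \o g) ->
  lam.-integrable A (EFin \o f).
Proof.
move=> mA mf fg; apply: le_integrable => //; first exact/measurable_EFinP.
by move=> x Ax /=; rewrite lee_fin; apply: le_trans (fg _ Ax) _; exact: ler_norm.
Qed.

Lemma integrable_realD (A : set R) f g : measurable A ->
  lam.-integrable A (EFin \o f) -> lam.-integrable A (EFin \o g) ->
  lam.-integrable A (EFin \o (fun x => f x + g x)).
Proof.
move=> mA fi gi; rewrite (_ : _ \o _ = (EFin \o f) \+ (EFin \o g))%E //.
exact: integrableD.
Qed.

Lemma integrable_realZ (A : set R) (k : R) f : measurable A ->
  lam.-integrable A (EFin \o f) -> lam.-integrable A (EFin \o (fun x => k * f x)).
Proof.
move=> mA fi; rewrite (_ : _ \o _ = (fun x => k%:E * (EFin \o f) x)%E) //.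
exact: integrableZl.
Qed.

Lemma measurable_fun_integrable (A : set R) f :
  lam.-integrable A (EFin \o f) -> measurable_fun A f.
Proof. by move=> /measurable_int/measurable_EFinP. Qed.

Lemma sq_int_mul f g : sq_int f -> sq_int g ->
  lam.-integrable posR (EFin \o (fun x => f x * g x)).
Proof.
move=> [mf fi] [mg gi].
apply: (le_integrable_real (g := fun x => f x ^+ 2 + g x ^+ 2)) => //.
- exact: measurable_funM.
- move=> x _; rewrite normrM -(real_normK (num_real (f x))) -(real_normK (num_real (g x))).
  by have := sqr_ge0 (`|f x| - `|g x|); have := sqr_ge0 (`|f x| + `|g x|); nra.
- exact: integrable_realD.
Qed.

Lemma sq_intP f : measurable_fun posR f ->
  sq_int f <-> (\int[lam]_(x in posR) (f x ^+ 2)%:E < +oo)%E.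
Proof.
move=> mf; have eqn : (\int[lam]_(x in posR) `|(EFin \o (fun x => (f x ^+ 2)%R)) x|)%E =
    (\int[lam]_(x in posR) (f x ^+ 2)%:E)%E.
  by apply: eq_integral => x _ /=; rewrite ger0_norm // sqr_ge0.
split=> [[_ /integrableP[_]]|fin]; first by rewrite eqn.
split => //; apply/integrableP; rewrite eqn; split => //.
by apply/measurable_EFinP; exact: measurable_funX.
Qed.

Lemma EFin_Rintegral (A : set R) f : measurable A -> lam.-integrable A (EFin \o f) ->
  (\int[lam]_(x in A) f x)%:E = (\int[lam]_(x in A) (f x)%:E)%E.
Proof. by move=> mA fi; rewrite fineK //; exact: integrable_fin_num. Qed.

(** Fatou's lemma, stated with an eventual bound on the integrals so that no
    limit inferior has to be computed. *)
Lemma real_fatou (A : set R) (F : nat -> R -> R) f (M : R) : measurable A ->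
  (forall n, measurable_fun A (F n)) -> measurable_fun A f ->
  (forall n x, A x -> 0 <= F n x) ->
  {ae lam, forall x, A x -> F n x @[n --> \oo] --> f x} ->
  (forall e, 0 < e -> \forall n \near \oo,
     (\int[lam]_(x in A) (F n x)%:E <= (M + e)%:E)%E) ->
  (forall x, A x -> 0 <= f x) ->
  (\int[lam]_(x in A) (f x)%:E <= M%:E)%E.
Proof.
move=> mA mF mf F0 Ff FM f0.
have mFE n : measurable_fun A (EFin \o F n) by exact/measurable_EFinP.
have FE0 n x : A x -> (0 <= (EFin \o F n) x)%E by move=> Ax; rewrite lee_fin F0.
have := fatou lam mA mFE FE0; move=> fat.
have -> : (\int[lam]_(x in A) (f x)%:E =
           \int[lam]_(x in A) limn_einf (fun n => (EFin \o F n) x))%E.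
  apply: ge0_ae_eq_integral => //.
  - exact/measurable_EFinP.
  - rewrite (_ : (fun x => _) = (fun x => - limn_esup (fun n => - (EFin \o F n) x))%E).
      apply: measurableT_comp => //;
        apply: (@measurable_fun_limn_esup _ _ _ _ (fun n x => - (F n x)%:E)%E) => n.
      by apply: measurableT_comp => //; exact: mFE.
    apply/funext => x; rewrite -limn_einfN; congr limn_einf.
    by apply/funext => n; rewrite /= opprK.
  - move=> x Ax; rewrite limn_einf_lim; apply: lime_ge; first exact: is_cvg_einfs.
    apply: nearW => n; apply: le_ereal_inf_tmp => _ [k /= _ <-]; exact: FE0.
  - apply: ae_imp Ff => x H /H {}H; apply/esym.
    have Hx : (EFin \o F n) x @[n --> \oo] --> (f x)%:E by apply: cvg_EFin => //; exact: nearW.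
    by rewrite (cvg_limn_einf_sup Hx).
apply: le_trans fat _; apply/lee_addgt0Pr => e e0; rewrite -EFinD.
rewrite limn_einf_lim; apply: lime_le; first exact: is_cvg_einfs.
have [N _ NP] := FM _ e0.
apply: nearW => n; apply: (@le_trans _ _ (\int[lam]_(x in A) (EFin \o F (maxn n N)) x)%E).
  apply: ereal_inf_lbound => /=; exists (maxn n N) => //=; exact: leq_maxl.
by apply: NP => /=; exact: leq_maxr.
Qed.

Lemma real_dct (A : set R) (F : nat -> R -> R) f g : measurable A ->
  (forall n, measurable_fun A (F n)) -> measurable_fun A f ->
  (forall n x, A x -> `|F n x| <= g x) -> lam.-integrable A (EFin \o g) ->
  {ae lam, forall x, A x -> F n x @[n --> \oo] --> f x} ->
  lam.-integrable A (EFin \o f) /\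
  \int[lam]_(x in A) F n x @[n --> \oo] --> \int[lam]_(x in A) f x.
Proof.
move=> mA mF mf Fg gi Ff.
have mFE n : measurable_fun A ((fun n => EFin \o F n) n) by apply/measurable_EFinP; exact: mF.
have mfE : measurable_fun A (EFin \o f) by exact/measurable_EFinP.
have cvE : {ae lam, forall x, A x -> (EFin \o F n) x @[n --> \oo] --> (EFin \o f) x}.
  by apply: ae_imp Ff => x H /H {}H; apply: cvg_EFin => //; exact: nearW.
have bE : {ae lam, forall x n, A x -> (`|(EFin \o F n) x| <= (EFin \o g) x)%E}.
  by apply: aeW => x n Ax /=; rewrite lee_fin Fg.
have [fi _ cv] := @dominated_convergence _ _ R lam A mA _ _ _ mFE mfE cvE gi bE.
split => //.
have cv' : (\int[lam]_(x in A) (F n x)%:E)%E @[n --> \oo] -->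
    (\int[lam]_(x in A) f x)%:E by rewrite EFin_Rintegral //; exact: cv.
exact: fine_cvg cv'.
Qed.

Lemma le_Rintegral_subset (A B : set R) f : measurable A -> measurable B ->
  A `<=` B -> (forall x, B x -> 0 <= f x) -> lam.-integrable B (EFin \o f) ->
  \int[lam]_(x in A) f x <= \int[lam]_(x in B) f x.
Proof.
move=> mA mB AB f0 fi; rewrite -lee_fin !EFin_Rintegral //; last exact: integrableS fi.
apply: ge0_subset_integral => //; exact: measurable_int fi.
Qed.

Lemma integral_tail g : lam.-integrable posR (EFin \o g) -> forall e, 0 < e ->
  exists n : nat, forall b, n%:R <= b ->
   `|\int[lam]_(x in posR) g x - \int[lam]_(x in `[0, b]) g x| <= e.
Proof.
move=> gi e e0.
have mT n : measurable (`]n%:R, +oo[%classic : set R) by exact: measurable_itv.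
have mg := measurable_fun_integrable gi.
have mng : measurable_fun posR (fun x => `|g x|) by exact: measurableT_comp.
have ing : lam.-integrable posR (EFin \o (fun x => `|g x|)).
  exact: integrable_norm gi.
have [] := @real_dct posR (fun n x => `|g x| * \1_(`]n%:R, +oo[%classic : set R) x)
  (cst 0) (fun x => `|g x|) _ _ _ _ ing _ => //.
- by move=> n; apply: measurable_funM => //; exact: measurable_indic.
- move=> n x _; rewrite normrM normr_id ler_piMr // indicE.
  by case: (_ \in _); rewrite ?normr1 ?normr0.
- apply: aeW => x _; apply: cvg_near_cst; near=> n.
  rewrite indicE memNset ?mulr0 //= in_itv /= andbT; apply/negP; rewrite -leNgt.
  near: n; exact: nbhs_infty_ger.
move=> _; rewrite Rintegral_cst // mul0r => /cvgrPdist_le/(_ _ e0)[n _ nP].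
exists n => b nb; have b0 : 0 <= b by rewrite (le_trans _ nb).
have gi0 : lam.-integrable `]0, b] (EFin \o g).
  by apply: integrableS gi => //; exact: subset_itvl.
have gib : lam.-integrable `]b, +oo[ (EFin \o g).
  apply: integrableS gi => //.
  by move=> x /=; rewrite posRE in_itv /= andbT; exact: le_lt_trans.
rewrite -Rintegral_itv_obnd_cbnd // Rintegral_itvB //.
have := nP n (leqnn n); rewrite sub0r normrN => /(le_trans _); apply.
apply: le_trans (ler_norm _).
apply: le_trans (le_normr_Rintegral _ gib) _ => //.
have -> : \int[lam]_(x in `]b, +oo[) `|g x| =
    \int[lam]_(x in `]b, +oo[) (`|g x| * \1_(`]n%:R, +oo[%classic : set R) x).
  apply: eq_Rintegral => x; rewrite inE /= in_itv /= andbT => bx.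
  by rewrite indicE mem_set ?mulr1 //= in_itv /= andbT (le_lt_trans nb).
apply: le_Rintegral_subset => //.
- by move=> x /=; rewrite posRE in_itv /= andbT; exact: le_lt_trans.
have ing1 : lam.-integrable posR
    (EFin \o (fun x : R => `|g x| * \1_(`]n%:R, +oo[%classic : set R) x)); last exact: ing1.
apply: (le_integrable_real _ _ _ ing) => //.
  by apply: measurable_funM => //; exact: measurable_indic.
move=> x _; rewrite normrM normr_id ler_piMr // indicE.
by case: (_ \in _); rewrite ?normr1 ?normr0.
Unshelve. all: by end_near. Qed.

End HalfLine.
#[global] Hint Resolve measurable_posR measurable_posR_sigma : core.

(** * Square-integrable functions with square-integrable derivative *)

Section DerivativeOnHalfLine.
Context {R : realType}.
Implicit Types (f g w : R -> R).
Local Notation lam := (@lebesgue_measure R).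
Local Notation posR := (@posR R).

Lemma measurable_lac w (A : set R) : lac w -> measurable_fun A w.
Proof.
by move=> lw; apply: measurable_funTS; apply: continuous_measurable_fun; exact: lac_continuous.
Qed.

Lemma measurable_derive1_lac w (A : set R) : lac w -> measurable_fun A (derive1 w).
Proof.
by move=> lw; apply: measurable_funTS; apply: measurable_derive1; exact: lac_continuous.
Qed.

Lemma ae_eq_Rintegral (A : set R) f g : measurable A ->
  measurable_fun A f -> measurable_fun A g ->
  {ae lam, forall x, A x -> f x = g x} ->
  \int[lam]_(x in A) f x = \int[lam]_(x in A) g x.
Proof.
move=> mA mf mg fg; rewrite /Rintegral; congr fine; apply: ae_eq_integral => //.
- exact/measurable_EFinP.
- exact/measurable_EFinP.
- by apply: ae_imp fg => x H /H ->.
Qed.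

Lemma integrable_cst_real (A : set R) (k : R) : measurable A -> (lam A < +oo)%E ->
  lam.-integrable A (EFin \o (fun=> k)).
Proof.
move=> mA Aoo; apply/integrableP; split; first exact: measurable_cst.
rewrite (_ : (fun x => _) = cst `|k|%:E) // integral_cst //.
by rewrite lte_mul_pinfty.
Qed.

Lemma lac_sq_ftc w b : lac w -> 0 <= b -> w 0 = 0 ->
  w b ^+ 2 / 2 = \int[lam]_(x in `[0, b]) (w x * derive1 w x).
Proof.
move=> lw b0 w0; have [iw E] := lac_ftc (lac_sq lw) b0.
move: E; rewrite w0 expr0n subr0 => ->.
have mi : measurable (`[0, b]%classic : set R) by exact: measurable_itv.
have mM : measurable_fun `[0, b]%classic (fun x => w x * derive1 w x).
  by apply: measurable_funM; [exact: measurable_lac|exact: measurable_derive1_lac].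
have sq' : {ae lam, forall x, `[0, b]%classic x ->
    derive1 (fun x => w x ^+ 2) x = 2 * (w x * derive1 w x)}.
  apply: ae_imp (lac_derivable lw) => x /derivable_sqr[_ ->] _.
  by rewrite mulrA.
have iM : lam.-integrable `[0, b] (EFin \o (fun x => w x * derive1 w x)).
  have iw2 := integrable_realZ 2^-1 mi iw.
  apply: ae_eq_integrable iw2 => //; first exact/measurable_EFinP.
  apply: ae_imp sq' => x H /H /= ->.
  by rewrite mulrA mulVf ?pnatr_eq0 // mul1r.
rewrite (ae_eq_Rintegral _ _ _ sq') //.
- by rewrite RintegralZl // mulrC mulrA mulVf ?pnatr_eq0 // mul1r.
- exact: measurable_fun_integrable iw.
- exact: measurable_funM.
Qed.

(** The function [w ^ 2] has the limit [2 * \int w w'] at infinity; it is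
    integrable, so that limit vanishes. *)
Lemma int_mul_derive w : lac w -> (forall x, x <= 0 -> w x = 0) ->
  sq_int w -> sq_int (derive1 w) -> \int[lam]_(x in posR) (w x * derive1 w x) = 0.
Proof.
move=> lw w0 sw sw'; set L := Rintegral _ _ _.
have iM := sq_int_mul sw sw'.
apply: contrapT => /eqP L0; have L20 : 0 < `|L| / 2 by rewrite divr_gt0 // normr_gt0.
have [n nP] := integral_tail iM L20.
have bnd b : n%:R <= b -> `|L - w b ^+ 2 / 2| <= `|L| / 2.
  move=> nb; have b0 : 0 <= b by apply: le_trans nb.
  by rewrite lac_sq_ftc // ?w0 //; exact: nP.
have Lpos : 0 < L.
  rewrite ltNge; apply/negP => L_le0; have := bnd _ (lexx _).
  rewrite ler_norml => /andP[+ _]; have := sqr_ge0 (w n%:R).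
  move: L20; rewrite (ler0_norm L_le0); lra.
have wL b : n%:R <= b -> L <= w b ^+ 2.
  by move=> /bnd; rewrite ler_norml (gtr0_norm Lpos) => /andP[_]; lra.
have [mw iw] := sw.
set I := \int[lam]_(x in posR) (w x ^+ 2).
have I0 : 0 <= I by apply: Rintegral_ge0 => x _; exact: sqr_ge0.
pose K := (I + 1) / L.
have K0 : 0 < K by rewrite divr_gt0 //; lra.
have : K * L <= I.
  have -> : K * L = \int[lam]_(x in `]n%:R, n%:R + K]) L.
    rewrite Rintegral_cst; last exact: measurable_itv.
    rewrite [X in fine X](@lebesgue_ocitv R) ?lerDl ?ltW //=.
    by rewrite addrAC subrr add0r mulrC.
  have sub : `]n%:R, n%:R + K]%classic `<=` posR.
    by move=> x /=; rewrite posRE in_itv /= => /andP[nx _]; exact: le_lt_trans nx.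
  have mi : measurable (`]n%:R, (n%:R + K)]%classic : set R) by exact: measurable_itv.
  apply: (@le_trans _ _ (\int[lam]_(x in `]n%:R, n%:R + K]) (w x ^+ 2))).
    apply: le_Rintegral => //.
    - apply: integrable_cst_real => //.
      by rewrite [X in (X < _)%E](@lebesgue_ocitv R) ?lerDl ?ltW // ltry.
    - exact: integrableS iw.
    - by move=> x /=; rewrite in_itv /= => /andP[nx _]; apply: wL; exact: ltW.
  by apply: le_Rintegral_subset => // x _; exact: sqr_ge0.
rewrite /K divfK ?gt_eqF //; lra.
Qed.

End DerivativeOnHalfLine.

(** * Dilations *)

Section Scaling.
Context {R : realType}.
Implicit Types (f g w : R -> R).
Local Notation lam := (@lebesgue_measure R).
Local Notation posR := (@posR R).
Variables (k : R) (k0 : 0 < k).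

Let scal (x : R) : R := k * x.

Let mscal : measurable_fun [set: R] scal.
Proof. exact: measurable_funM. Qed.

Let image_scal : {measure set (measurableTypeR R) -> \bar R}.
Proof. by refine (pushforward lam (scal : measurableTypeR R -> measurableTypeR R)). Defined.

(** The rescaled image measure agrees with the Lebesgue measure on intervals. *)
Lemma lebesgue_scale (A : set R) : measurable A ->
  lam A = (k%:E * lam (scal @^-1` A))%E.
Proof.
move=> mA.
pose m : {measure set (measurableTypeR R) -> \bar R} := mscale (NngNum (ltW k0)) image_scal.
rewrite (@lebesgue_measure_unique _ m) // => X /ocitvP[->|[[a b] /= ab ->]].
  by rewrite !measure0.
rewrite lebesgue_ocitv ?ltW // /m /mscale /= /pushforward.
rewrite (_ : _ @^-1` _ = `]a / k, b / k]%classic); last first.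
  apply/seteqP; split => x; rewrite /= !in_itv /= /scal ltr_pdivrMr // ler_pdivlMr //.
    by rewrite mulrC.
  by rewrite mulrC.
rewrite lebesgue_ocitv; last by rewrite ler_pM2r ?invr_gt0 // ltW.
by rewrite -EFinM -mulrBl mulrC divfK // gt_eqF.
Qed.

Lemma ge0_integral_scale (B : set R) (f : R -> \bar R) : measurable B ->
  measurable_fun B f -> (forall x, B x -> (0 <= f x)%E) ->
  (\int[lam]_(x in B) f x = k%:E * \int[lam]_(x in scal @^-1` B) f (k * x)%R)%E.
Proof.
move=> mB mf f0.
pose m : {measure set (measurableTypeR R) -> \bar R} := mscale (NngNum (ltW k0)) image_scal.
transitivity (\int[m]_(x in B) f x)%E.
  by apply: eq_measure_integral => A mA _; exact: lebesgue_scale.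
rewrite ge0_integral_mscale //= ge0_integral_pushforward //.
by move=> x; rewrite inE; exact: f0.
Qed.

Lemma Rintegral_scale (B : set R) f : measurable B ->
  lam.-integrable B (EFin \o f) ->
  lam.-integrable (scal @^-1` B) (EFin \o (fun x => f (k * x))) /\
  \int[lam]_(x in scal @^-1` B) f (k * x) = k^-1 * \int[lam]_(x in B) f x.
Proof.
move=> mB fi.
have mB' : measurable (scal @^-1` B) by rewrite -[X in measurable X]setTI; exact: mscal.
have mf := measurable_fun_integrable fi.
have mf' : measurable_fun (scal @^-1` B) (fun x => f (k * x)).
  by apply: (measurable_comp mB _ mf); [move=> _ [x + <-]|exact: measurable_funTS].
have pos (h : R -> R) : measurable_fun B h -> (forall x, 0 <= h x) ->
    (\int[lam]_(x in B) (h x)%:E = k%:E * \int[lam]_(x in scal @^-1` B) (h (k * x))%:E)%E.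
  by move=> mh h0; apply: (ge0_integral_scale (f := EFin \o h)) => //; [exact/measurable_EFinP|
    move=> x _ /=; rewrite lee_fin].
have fi' : lam.-integrable (scal @^-1` B) (EFin \o (fun x => f (k * x))).
  apply/integrableP; split; first exact/measurable_EFinP.
  have /integrableP[_] := fi.
  rewrite (_ : (fun x => `|(EFin \o f) x|%E) = EFin \o (fun x => `|f x|)) //.
  rewrite [X in (X < _)%E -> _]pos //; last exact: measurableT_comp.
  move=> h; rewrite ltey; apply/eqP => e; move: h; rewrite /= [X in (_ * X)%E]e.
  by rewrite gt0_muley ?lte_fin.
split => //.
have dec (C : set R) (h : R -> R) : measurable C -> lam.-integrable C (EFin \o h) ->
    \int[lam]_(x in C) h x =
    \int[lam]_(x in C) Num.max (h x) 0 - \int[lam]_(x in C) Num.max (- h x) 0.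
  move=> mC hi; have mh := measurable_fun_integrable hi.
  rewrite -RintegralB //.
  - by apply: eq_Rintegral => x _; rewrite !maxEle; do 2 case: leP => ?; lra.
  - apply: (le_integrable_real _ _ _ (integrable_norm hi)) => //.
      exact: measurable_funrpos.
    by move=> x _ /=; rewrite ger0_norm ?le_max ?lexx ?orbT // ge_max normr_ge0 ler_norm.
  - apply: (le_integrable_real _ _ _ (integrable_norm hi)) => //.
      exact: measurable_funrneg.
    by move=> x _ /=; rewrite ger0_norm ?le_max ?lexx ?orbT // ge_max normr_ge0 -normrN ler_norm.
rewrite (dec _ _ mB fi) (dec _ _ mB' fi') mulrBr.
have pos' (h : R -> R) : measurable_fun B h -> (forall x, 0 <= h x) ->
    \int[lam]_(x in scal @^-1` B) (h (k * x)) = k^-1 * \int[lam]_(x in B) h x.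
  move=> mh h0; rewrite /Rintegral pos //.
  case: (\int[lam]_(x in scal @^-1` B) (h (k * x))%:E)%E => [r| |] /=.
  - by rewrite mulrA mulVf ?mul1r // gt_eqF.
  - by rewrite gt0_muley ?lte_fin //= mulr0.
  - by rewrite gt0_muleNy ?lte_fin //= mulr0.
congr (_ - _); apply: pos'.
- exact: measurable_funrpos.
- by move=> x; rewrite le_max lexx orbT.
- exact: measurable_funrneg.
- by move=> x; rewrite le_max lexx orbT.
Qed.

End Scaling.

(** * Normalized real functions on the half-line *)

Section Admissible.
Context {R : realType}.
Implicit Types (f g u v phi psi : R -> R).
Local Notation lam := (@lebesgue_measure R).
Local Notation posR := (@posR R).

Lemma eq_posR f g : (forall x, 0 < x -> f x = g x) -> {in posR, f =1 g}.
Proof. by move=> fg x; rewrite inE posRE; exact: fg. Qed.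

Lemma sq_int_eq f g : (forall x, 0 < x -> f x = g x) -> sq_int f -> sq_int g.
Proof.
move=> fg [mf fi]; split.
  by apply: eq_measurable_fun mf; exact: eq_posR.
by apply: eq_integrable fi => // x; rewrite inE posRE /= => /fg ->.
Qed.

Lemma sq_intD f g : sq_int f -> sq_int g -> sq_int (fun x => f x + g x).
Proof.
move=> [mf fi] [mg gi]; have mfg := measurable_funD mf mg; split => //.
apply: (le_integrable_real (g := fun x => 2 * f x ^+ 2 + 2 * g x ^+ 2)) => //.
- exact: measurable_funX.
- move=> x _; rewrite ger0_norm ?sqr_ge0 //.
  by have := sqr_ge0 (f x - g x); rewrite !expr2; lra.
- by apply: integrable_realD => //; exact: integrable_realZ.
Qed.

Lemma sq_intZ (c : R) f : sq_int f -> sq_int (fun x => c * f x).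
Proof.
move=> [mf fi]; split; first exact: measurable_funM.
apply: eq_integrable (integrable_realZ (c ^+ 2) measurable_posR fi) => // x _ /=.
by rewrite exprMn.
Qed.

Lemma scale_posR (k : R) f : 0 < k -> lam.-integrable posR (EFin \o f) ->
  lam.-integrable posR (EFin \o (fun x => f (k * x))) /\
  \int[lam]_(x in posR) f (k * x) = k^-1 * \int[lam]_(x in posR) f x.
Proof.
move=> k0 fi; have := Rintegral_scale k0 measurable_posR fi.
rewrite (_ : _ @^-1` _ = posR) //.
by apply/seteqP; split => x; rewrite /preimage /= !posRE pmulr_rgt0.
Qed.

Lemma measurable_scale (k : R) f : 0 < k -> measurable_fun posR f ->
  measurable_fun posR (fun x => f (k * x)).
Proof.
move=> k0 mf; apply: (measurable_comp measurable_posR _ mf).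
  by move=> _ [x + <-]; rewrite !posRE => x0; rewrite mulr_gt0.
by apply: measurable_funTS; exact: measurable_funM.
Qed.

Lemma sq_int_scale (c k : R) f : 0 < k -> sq_int f ->
  sq_int (fun x => c * f (k * x)) /\
  \int[lam]_(x in posR) (c * f (k * x)) ^+ 2 =
  c ^+ 2 / k * \int[lam]_(x in posR) f x ^+ 2.
Proof.
move=> k0 [mf fi]; have [fi' E] := scale_posR k0 fi; split.
  by apply: sq_intZ; split => //; exact: measurable_scale.
rewrite -mulrA -E -RintegralZl //.
by apply: eq_Rintegral => x _; rewrite exprMn.
Qed.

(** [phi] is a weak derivative of [u]. It is carried along instead of being
    recomputed as [derive1 u], since dilations and limits act on it directly. *)
Record half_line_function u phi : Prop := HalfLineFunction {
  hlf_neg : forall x, x <= 0 -> u x = 0;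
  hlf_ftc : forall s t, 0 <= s -> s <= t ->
    u t - u s = \int[lam]_(x in `[s, t]) phi x;
  hlf_int : forall s t, 0 <= s -> s <= t -> lam.-integrable `[s, t] (EFin \o phi);
  hlf_derive : sq_int phi;
  hlf_sq : sq_int u;
  hlf_ln : sq_int (fun x => ln x * u x);
  hlf_norm : \int[lam]_(x in posR) u x ^+ 2 = 1 }.

Definition log_mean u := \int[lam]_(x in posR) (ln x * u x ^+ 2).

(** Every dilation orbit meets the constraint [log_mean u = 0] exactly once, and
    under this constraint the uncertainty of [u] becomes the quadratic [energy]. *)
Definition admissible u phi := half_line_function u phi /\ log_mean u = 0.

Definition kinetic phi := \int[lam]_(x in posR) phi x ^+ 2.
Definition log_second u := \int[lam]_(x in posR) (ln x * u x) ^+ 2.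

Definition energy u phi := kinetic phi + log_second u.

Lemma log_mean_integrable u : sq_int u -> sq_int (fun x => ln x * u x) ->
  lam.-integrable posR (EFin \o (fun x => ln x * u x ^+ 2)).
Proof.
move=> su sl; apply: eq_integrable (sq_int_mul sl su) => // x _ /=.
by rewrite expr2 mulrA.
Qed.

Lemma centered_log_second u (m : R) : sq_int u -> sq_int (fun x => ln x * u x) ->
  \int[lam]_(x in posR) u x ^+ 2 = 1 ->
  \int[lam]_(x in posR) ((ln x - m) * u x) ^+ 2 =
  log_second u - 2 * m * log_mean u + m ^+ 2.
Proof.
move=> su sl u1; have lm := log_mean_integrable su sl.
have i1 := integrable_realZ (- (2 * m)) measurable_posR lm.
have i2 := integrable_realZ (m ^+ 2) measurable_posR (proj2 su).
have i12 := integrable_realD measurable_posR (proj2 sl) i1.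
transitivity (\int[lam]_(x in posR) ((ln x * u x) ^+ 2 + - (2 * m) * (ln x * u x ^+ 2)
   + m ^+ 2 * u x ^+ 2)).
  by apply: eq_Rintegral => x _; ring.
rewrite RintegralD // RintegralD ?(proj2 sl) // !RintegralZl ?(proj2 su) // u1 mulr1.
by rewrite mulNr.
Qed.

(** Dilation by [k = exp m], where [m] is the logarithmic mean, moves that mean
    to [0]. It multiplies the kinetic term by [k ^ 2] and turns [ln ^ 2] into
    [(ln - m) ^ 2], which are the two terms of the uncertainty. *)
Lemma dilate v psi : half_line_function v psi ->
  exists u phi, admissible u phi /\
    energy u phi = expR (2 * log_mean v) * kinetic psi + (log_second v - log_mean v ^+ 2).
Proof.
move=> [vneg vftc vint spsi sv sln v1].
set m := log_mean v; pose k := expR m; have k0 : 0 < k by exact: expR_gt0.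
pose c := Num.sqrt k; have c2 : c ^+ 2 = k by rewrite sqr_sqrtr // ltW.
have lnk x : 0 < x -> ln x = ln (k * x) - m.
  by move=> x0; rewrite lnM ?posrE // expRK addrAC subrr add0r.
pose g x := (ln x - m) * v x.
have sg : sq_int g.
  apply: sq_int_eq (sq_intD sln (sq_intZ (- m) sv)) => x _.
  by rewrite /g mulrBl mulNr.
have gE : \int[lam]_(x in posR) g x ^+ 2 = log_second v - m ^+ 2.
  by rewrite centered_log_second // -/m; ring.
exists (fun x => c * v (k * x)), (fun x => k * c * psi (k * x)).
have [su uE] := sq_int_scale c k0 sv.
have [sphi phiE] := sq_int_scale (k * c) k0 spsi.
have [sl lE] := sq_int_scale c k0 sg.
have lnE x : 0 < x -> c * g (k * x) = ln x * (c * v (k * x)).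
  by move=> x0; rewrite /g -lnk //; ring.
have kn0 : k != 0 by rewrite gt_eqF.
have pre s t : (fun x => k * x) @^-1` `[k * s, k * t]%classic = `[s, t]%classic.
  by apply/seteqP; split => x; rewrite /= !in_itv /= !ler_pM2l.
have ints s t : 0 <= s -> s <= t ->
    lam.-integrable `[s, t] (EFin \o (fun x => psi (k * x))) /\
    \int[lam]_(x in `[s, t]) psi (k * x) = k^-1 * (v (k * t) - v (k * s)).
  move=> s0 st; have ks0 : 0 <= k * s by rewrite mulr_ge0 // ltW.
  have kst : k * s <= k * t by rewrite ler_pM2l.
  have := Rintegral_scale k0 (measurable_itv _) (vint _ _ ks0 kst).
  by rewrite pre vftc.
split; first split.
- split => //.
  + by move=> x x0; rewrite vneg ?mulr0 // pmulr_rle0.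
  + move=> s t s0 st; have [i1 E1] := ints _ _ s0 st.
    by rewrite RintegralZl // E1 mulrACA divff // mul1r mulrBr.
  + move=> s t s0 st; have [i1 E1] := ints _ _ s0 st.
    exact: integrable_realZ.
  + by apply: sq_int_eq lnE sl.
  + by rewrite uE v1 c2 divff // mulr1.
- have lmv := log_mean_integrable sv sln.
  pose h y := (ln y - m) * v y ^+ 2.
  have hi : lam.-integrable posR (EFin \o h).
    apply: eq_integrable (integrable_realD measurable_posR lmv
      (integrable_realZ (- m) measurable_posR (proj2 sv))) => // x _ /=.
    by rewrite /h mulrBl mulNr.
  have hE : \int[lam]_(x in posR) h x = 0.
    rewrite /h; under eq_Rintegral do rewrite mulrBl.
    rewrite RintegralB //; last by apply: integrable_realZ => //; exact: (proj2 sv).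
    rewrite RintegralZl //; last exact: (proj2 sv).
    by rewrite v1 mulr1 subrr.
  have [hi' E] := scale_posR k0 hi.
  rewrite /log_mean (_ : 0 = k * \int[lam]_(x in posR) h (k * x)); last first.
    by rewrite E hE !mulr0.
  rewrite -RintegralZl //; apply: eq_Rintegral; apply: eq_posR => x x0.
  by rewrite exprMn c2 /h -lnk //; ring.
rewrite /energy /kinetic phiE exprMn c2; congr (_ + _).
  rewrite (_ : expR _ = k ^+ 2); last by rewrite -expRM_natl.
  by rewrite -[k ^+ 2 * k / k]mulrA divff // mulr1.
rewrite -gE; transitivity (\int[lam]_(x in posR) (c * g (k * x)) ^+ 2).
  by apply: eq_Rintegral; apply: eq_posR => x x0; rewrite lnE.
by rewrite lE c2 divff // mul1r.
Qed.

End Admissible.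

(** * The uncertainty of a complex signal and of its modulus *)

Section Pairs.
Context {R : realType}.
Implicit Types (w u v : R -> R) (g : R -> R[i]).
Local Notation lam := (@lebesgue_measure R).
Local Notation posR := (@posR R).

Lemma cmod_sqr (z : R[i]) : cmod z ^+ 2 = Re z ^+ 2 + Im z ^+ 2.
Proof. by rewrite /cmod sqr_sqrtr // addr_ge0 // sqr_ge0. Qed.

Lemma norm2_sqr g : norm2 g ^+ 2 = \int[lam]_(x in posR) (Re (g x) ^+ 2 + Im (g x) ^+ 2).
Proof.
rewrite /norm2 sqr_sqrtr; last by apply: Rintegral_ge0 => x _; exact: sqr_ge0.
by apply: eq_Rintegral => x _; rewrite cmod_sqr.
Qed.

Record regular_pair g : Prop := RegularPair {
  rp_lac1 : lac (fun x => Re (g x));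
  rp_lac2 : lac (fun x => Im (g x));
  rp_neg : forall x, x <= 0 -> g x = 0;
  rp_sq1 : sq_int (fun x => Re (g x));
  rp_sq2 : sq_int (fun x => Im (g x));
  rp_derive1 : sq_int (derive1 (fun x => Re (g x)));
  rp_derive2 : sq_int (derive1 (fun x => Im (g x)));
  rp_ln1 : sq_int (fun x => ln x * Re (g x));
  rp_ln2 : sq_int (fun x => ln x * Im (g x)) }.

Section RegularPair.
Variable g : R -> R[i].
Hypothesis rg : regular_pair g.
Let g1 x := Re (g x).
Let g2 x := Im (g x).
Let d1 := derive1 g1.
Let d2 := derive1 g2.

(** The imaginary part of [<Tx g, g>] is the integral of half the derivative of
    [|g| ^ 2], hence [0]; this is what remains, the mean of [Tx]. *)
Definition frequency := \int[lam]_(x in posR) (d1 x * g2 x - d2 x * g1 x).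

Lemma mean_TxE : mean (@Tx R) g = frequency%:C.
Proof.
have [l1 l2 neg s1 s2 t1 t2 n1 n2] := rg.
have neg1 x : x <= 0 -> g1 x = 0 by move=> /neg; rewrite /g1 => ->.
have neg2 x : x <= 0 -> g2 x = 0 by move=> /neg; rewrite /g2 => ->.
rewrite /mean /inner /frequency; congr (_ +i* _).
  apply: eq_Rintegral => x _; rewrite /Tx /cderiv -/g1 -/g2 -/d1 -/d2.
  by rewrite /g1 /g2; case: (g x) => a b /=; simpc => /=; ring.
transitivity (\int[lam]_(x in posR) (g1 x * d1 x) + \int[lam]_(x in posR) (g2 x * d2 x)).
  rewrite -RintegralD //; [|exact: sq_int_mul|exact: sq_int_mul].
  apply: eq_Rintegral => x _; rewrite /Tx /cderiv -/g1 -/g2 -/d1 -/d2.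
  by rewrite /g1 /g2; case: (g x) => a b /=; simpc => /=; ring.
by rewrite !int_mul_derive // addr0.
Qed.

Lemma variance_TxE : Defs.variance (@Tx R) g =
  \int[lam]_(x in posR) ((d2 x + frequency * g1 x) ^+ 2 + (d1 x - frequency * g2 x) ^+ 2).
Proof.
rewrite /Defs.variance norm2_sqr mean_TxE; apply: eq_Rintegral => x _.
rewrite /Tx /cderiv -/g1 -/g2 -/d1 -/d2 /g1 /g2.
by case: (g x) => a b /=; simpc => /=; ring.
Qed.

Let m := \int[lam]_(x in posR) (ln x * (g1 x ^+ 2 + g2 x ^+ 2)).

Lemma mean_TsigmaE : Re (mean (@Tsigma R) g) = - m.
Proof.
have [l1 l2 neg s1 s2 t1 t2 n1 n2] := rg.
rewrite /mean /inner /= /m -mulN1r -RintegralZl //.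
  apply: eq_Rintegral => x _; rewrite /Tsigma /g1 /g2.
  by case: (g x) => a b /=; simpc => /=; ring.
have h := integrable_realD measurable_posR (sq_int_mul n1 s1) (sq_int_mul n2 s2).
by apply: eq_integrable h => // x _ /=; rewrite /g1 /g2; congr (_ %:E); ring.
Qed.

Lemma variance_TsigmaE : Defs.variance (@Tsigma R) g =
  \int[lam]_(x in posR) ((ln x - m) ^+ 2 * (g1 x ^+ 2 + g2 x ^+ 2)).
Proof.
rewrite /Defs.variance norm2_sqr.
have -> : mean (@Tsigma R) g = (- m)%:C.
  have := mean_TsigmaE; have := Im_mean_Tsigma g.
  by case: (mean _ _) => a b /= -> ->.
apply: eq_Rintegral => x _; rewrite /Tsigma /g1 /g2.
by case: (g x) => a b /=; simpc => /=; ring.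
Qed.

End RegularPair.

(** Pointwise diamagnetic inequality: the modulus of a complex function varies at
    most as fast as any modulation of it. Away from the zeros of [u] it is the
    Cauchy-Schwarz inequality for [u u' = w1 w1' + w2 w2']; at a zero, where [u] is
    the length of the increment, difference quotients are compared directly. *)
Lemma diamagnetic (w1 w2 u : R -> R) (a x : R) :
  (forall y, u y = Num.sqrt (w1 y ^+ 2 + w2 y ^+ 2)) ->
  derivable w1 x 1 -> derivable w2 x 1 -> derivable u x 1 ->
  derive1 u x ^+ 2 <=
    (derive1 w2 x + a * w1 x) ^+ 2 + (derive1 w1 x - a * w2 x) ^+ 2.
Proof.
move=> uE dw1 dw2 du.
have u2 y : u y ^+ 2 = w1 y ^+ 2 + w2 y ^+ 2.
  by rewrite uE sqr_sqrtr // addr_ge0 // sqr_ge0.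
have [ux0|ux0] := eqVneq (u x) 0.
  have [w10 w20] : w1 x = 0 /\ w2 x = 0.
    have := u2 x; rewrite ux0 expr0n /= => /esym/eqP.
    by rewrite paddr_eq0 ?sqr_ge0 // !sqrf_eq0 => /andP[/eqP-> /eqP->].
  rewrite w10 w20 !mulr0 addr0 subr0 addrC -subr_ge0.
  have c1 := cvg_sqr (derivable_slope_seq dw1).
  have c2 := cvg_sqr (derivable_slope_seq dw2).
  have cv : (slope w1 x n.+1%:R^-1 ^+ 2 + slope w2 x n.+1%:R^-1 ^+ 2 -
      slope u x n.+1%:R^-1 ^+ 2) @[n --> \oo] -->
      derive1 w1 x ^+ 2 + derive1 w2 x ^+ 2 - derive1 u x ^+ 2.
    exact: (cvgB (cvgD c1 c2) (cvg_sqr (derivable_slope_seq du))).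
  rewrite -(cvg_lim _ cv) //; apply: limr_ge; first by apply/cvg_ex; eexists; exact: cv.
  apply: nearW => n /=; rewrite /slope w10 w20 ux0 !subr0 !exprMn u2; lra.
have E : u x * derive1 u x = w1 x * derive1 w1 x + w2 x * derive1 w2 x.
  have [d1 E1] := derivable_sqr dw1; have [d2 E2] := derivable_sqr dw2.
  have [_ Eu] := derivable_sqr du; have [_ ED] := derivable_add d1 d2.
  move: Eu; rewrite (_ : (fun y => u y ^+ 2) = fun y => w1 y ^+ 2 + w2 y ^+ 2).
    by rewrite ED E1 E2; lra.
  by apply/funext => y; exact: u2.
have ux : 0 < u x ^+ 2 by rewrite exprn_even_gt0.
rewrite -(ler_pM2l ux) -exprMn E u2.
set p := w1 x; set q := w2 x; set s := derive1 w1 x; set t := derive1 w2 x.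
rewrite -subr_ge0 (_ : _ - _ = (p * (t + a * p) - q * (s - a * q)) ^+ 2); last by ring.
exact: sqr_ge0.
Qed.

Lemma cmodD (z1 z2 : R[i]) : cmod (z1 + z2) <= cmod z1 + cmod z2.
Proof. by have := ler_normD z1 z2; rewrite !cmodE -rmorphD /= lecR. Qed.

Lemma cmod_le (z : R[i]) : cmod z <= `|Re z| + `|Im z|.
Proof.
rewrite -ler_sqr ?nnegrE ?cmod_ge0 ?addr_ge0 // cmod_sqr.
rewrite -(real_normK (num_real (Re z))) -(real_normK (num_real (Im z))) sqrrD.
by rewrite lerD2r lerDl mulrn_wge0 // mulr_ge0.
Qed.

Lemma cmod_dist (z1 z2 : R[i]) :
  `|cmod z2 - cmod z1| <= `|Re z2 - Re z1| + `|Im z2 - Im z1|.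
Proof.
have le (w1 w2 : R[i]) : cmod w2 - cmod w1 <= `|Re w2 - Re w1| + `|Im w2 - Im w1|.
  have := cmodD (w2 - w1) w1; have := cmod_le (w2 - w1); rewrite subrK.
  by case: w1 => a b; case: w2 => c d /=; lra.
rewrite ler_norml lerNl opprB le andbT.
by rewrite (distrC (Re _)) (distrC (Im _)).
Qed.

Lemma lac_le (f w1 w2 : R -> R) : lac w1 -> lac w2 ->
  (forall x y, `|f y - f x| <= `|w1 y - w1 x| + `|w2 y - w2 x|) -> lac f.
Proof.
by move=> l1 l2 H a b ab; apply: (ac_le (l1 a b ab) (l2 a b ab)) => x y _; exact: H.
Qed.

(** The modulus has the same density as [g], hence the same logarithmic moments,
    and by the diamagnetic inequality at most its kinetic energy. *)
Lemma modulus_pair g : regular_pair g ->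
  \int[lam]_(x in posR) (Re (g x) ^+ 2 + Im (g x) ^+ 2) = 1 ->
  exists u phi, [/\ half_line_function u phi,
    log_mean u = - Re (mean (@Tsigma R) g),
    kinetic phi <= Defs.variance (@Tx R) g &
    Defs.variance (@Tsigma R) g = log_second u - log_mean u ^+ 2].
Proof.
move=> rg g1E; have [l1 l2 neg s1 s2 t1 t2 n1 n2] := rg.
pose u x := cmod (g x).
have u2 x : u x ^+ 2 = Re (g x) ^+ 2 + Im (g x) ^+ 2 by exact: cmod_sqr.
have lu : lac u.
  by apply: (lac_le l1 l2) => x y; exact: cmod_dist.
have su : sq_int u.
  split; first exact: measurable_lac.
  apply: eq_integrable (integrable_realD measurable_posR (proj2 s1) (proj2 s2)) => // x _ /=.
  by rewrite u2.
have sl : sq_int (fun x => ln x * u x).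
  split; first by apply: measurable_funM; [exact: measurable_funTS|exact: measurable_lac].
  apply: eq_integrable (integrable_realD measurable_posR (proj2 n1) (proj2 n2)) => // x _ /=.
  by rewrite !exprMn u2 mulrDr.
have u1 : \int[lam]_(x in posR) u x ^+ 2 = 1 by under eq_Rintegral do rewrite u2.
pose h x := (derive1 (fun y => Im (g y)) x + frequency g * Re (g x)) ^+ 2 +
     (derive1 (fun y => Re (g y)) x - frequency g * Im (g x)) ^+ 2.
have hi : lam.-integrable posR (EFin \o h).
  apply: integrable_realD => //; apply: (proj2 (_ : sq_int _)); apply: sq_intD => //.
    exact: sq_intZ.
  have := sq_intZ (- frequency g) s2; apply: sq_int_eq => x _; by rewrite mulNr.
have ae_h : {ae lam, forall x, derive1 u x ^+ 2 <= h x}.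
  apply: ae_imp2 (lac_derivable lu) (_ : {ae lam, forall x,
    derivable (fun y => Re (g y)) x 1 /\ derivable (fun y => Im (g y)) x 1}).
    by move=> x du [dg1 dg2]; exact: (@diamagnetic (fun y => Re (g y)) (fun y => Im (g y)) u _ x).
  exact: (ae_imp2 (fun x h1 h2 => conj h1 h2) (lac_derivable l1) (lac_derivable l2)).
have mu' : measurable_fun posR (derive1 u) by exact: measurable_derive1_lac.
have le_h : (\int[lam]_(x in posR) (derive1 u x ^+ 2)%:E <= \int[lam]_(x in posR) (h x)%:E)%E.
  apply: ae_ge0_le_integral => //.
  - by move=> x _; rewrite lee_fin sqr_ge0.
  - by apply/measurable_EFinP; exact: measurable_funX.
  - by move=> x _; rewrite lee_fin addr_ge0 // sqr_ge0.
  - exact: measurable_int hi.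
  - by apply: ae_imp ae_h => x H _; rewrite lee_fin.
have su' : sq_int (derive1 u).
  apply/sq_intP => //; apply: le_lt_trans le_h _.
  by rewrite -EFin_Rintegral // ltry.
exists u, (derive1 u); split.
- split => //.
  + by move=> x /neg; rewrite /u => ->; rewrite cmod_real normr0.
  + by move=> s t _ st; have [] := lac_ftc lu st.
  + by move=> s t _ st; have [] := lac_ftc lu st.
- rewrite mean_TsigmaE // opprK /log_mean; apply: eq_Rintegral => x _.
  by rewrite u2.
- rewrite variance_TxE // -lee_fin !EFin_Rintegral //; last exact: (proj2 su').
- rewrite variance_TsigmaE //.
  set m := \int[lam]_(x in posR) (ln x * (Re (g x) ^+ 2 + Im (g x) ^+ 2)).
  have mE : m = log_mean u by apply: eq_Rintegral => x _; rewrite u2.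
  rewrite (_ : log_second u - _ = log_second u - 2 * m * log_mean u + m ^+ 2); last first.
    by rewrite mE; ring.
  rewrite -centered_log_second //; apply: eq_Rintegral => x _.
  by rewrite exprMn u2.
Qed.

End Pairs.

(** * Signals and real competitors *)

Section Signals.
Context {R : realType}.
Implicit Types (w u : R -> R) (f g : R -> R[i]).
Local Notation lam := (@lebesgue_measure R).
Local Notation posR := (@posR R).

Lemma memL2_sq_int f : memL2 f ->
  sq_int (fun x => Re (f x)) /\ sq_int (fun x => Im (f x)).
Proof.
move=> [m1 m2 fin].
have mc : measurable_fun [set: R] (fun x => cmod (f x) ^+ 2).
  rewrite (_ : (fun x => _) = (fun x => Re (f x) ^+ 2 + Im (f x) ^+ 2)); last first.
    by apply/funext => x; rewrite cmod_sqr.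
  by apply: measurable_funD; exact: measurable_funX.
have key (h : R -> R) : measurable_fun [set: R] h ->
    (forall x, h x ^+ 2 <= cmod (f x) ^+ 2) -> sq_int h.
  move=> mh hf; have mh' : measurable_fun posR h by exact: measurable_funTS.
  apply/sq_intP => //; apply: le_lt_trans fin.
  apply: (@le_trans _ _ (\int[lam]_(x in posR) (cmod (f x) ^+ 2)%:E)%E).
    apply: ge0_le_integral => //.
    - by move=> x _; rewrite lee_fin sqr_ge0.
    - by apply/measurable_EFinP; exact: measurable_funX.
    - by apply/measurable_EFinP; exact: measurable_funTS.
    - by move=> x _; rewrite lee_fin.
  apply: ge0_subset_integral => //; first exact/measurable_EFinP.
  by move=> x _; rewrite lee_fin sqr_ge0.
split; apply: key => // x; rewrite cmod_sqr ?lerDl ?lerDr ?sqr_ge0 //.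
Qed.

Lemma continuous_at0 w : continuous w -> (forall x, x < 0 -> w x = 0) -> w 0 = 0.
Proof.
move=> cw w0; apply/eqP; apply: contrapT => /negP n0.
have /cvgrPdist_lt/(_ `|w 0|) := cw 0; rewrite normr_gt0 n0 => /(_ isT).
move=> /nbhs_ballP[e /= e0 eP].
have := eP (- (e / 2)); rewrite /ball /= sub0r opprK gtr0_norm ?divr_gt0 //.
rewrite ltr_pdivrMr // ltr_pMr // ltr1n => /(_ isT).
have e20 : - (e / 2) < 0 by rewrite ltrNl oppr0 divr_gt0.
by rewrite (w0 _ e20) subr0 ltxx.
Qed.

Lemma dom_LS_regular f : dom_LS f -> regular_pair f.
Proof.
move=> [[[m neg] acf md] [_ [ml _]]].
have [s1 s2] := memL2_sq_int m; have [d1 d2] := memL2_sq_int md.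
have [n1 n2] := memL2_sq_int ml.
have l1 : lac (fun x => Re (f x)).
  apply: (lac_of_abs_cont_on acf) => x y.
  case: (f x) => a b; case: (f y) => c d; rewrite /cmod /= -sqrtr_sqr.
  by rewrite ler_wsqrtr // lerDl sqr_ge0.
have l2 : lac (fun x => Im (f x)).
  apply: (lac_of_abs_cont_on acf) => x y.
  case: (f x) => a b; case: (f y) => c d; rewrite /cmod /= -sqrtr_sqr.
  by rewrite ler_wsqrtr // lerDr sqr_ge0.
have f0 : f 0 = 0.
  have e1 : Re (f 0) = 0.
    by apply: (continuous_at0 (lac_continuous l1)) => x /neg ->.
  have e2 : Im (f 0) = 0.
    by apply: (continuous_at0 (lac_continuous l2)) => x /neg ->.
  by move: e1 e2; case: (f 0) => a b /= -> ->.
split => //.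
- by move=> x; rewrite le_eqVlt => /predU1P[->//|/neg].
- by apply: sq_int_eq n1 => x _; case: (f x) => a b /=; ring.
- by apply: sq_int_eq n2 => x _; case: (f x) => a b /=; ring.
Qed.

Lemma lacZ (c : R) w : lac w -> lac (fun x => c * w x).
Proof.
move=> lw a b ab; apply: (ac_lip (K := `|c|) _ (lw a b ab)) => // x y /=.
by rewrite -mulrBr normrM.
Qed.

Lemma derive1_lacZ (c : R) w : lac w ->
  {ae lam, forall x, derive1 (fun y => c * w y) x = c * derive1 w x}.
Proof.
by move=> lw; apply: ae_imp (lac_derivable lw) => x /(derivable_scale c)[].
Qed.

Lemma sq_int_derive1Z (c : R) w : lac w -> sq_int (derive1 w) ->
  sq_int (derive1 (fun x => c * w x)).
Proof.
move=> lw sw; have [mc ic] := sq_intZ c sw.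
have md : measurable_fun posR (derive1 (fun x => c * w x)).
  by apply: measurable_derive1_lac; exact: lacZ.
split => //; apply: ae_eq_integrable ic => //.
  by apply/measurable_EFinP; exact: measurable_funX.
by apply: ae_imp (derive1_lacZ c lw) => x /= -> _.
Qed.

Lemma regular_pairZ (c : R) g : regular_pair g -> regular_pair (fun x => c%:C * g x).
Proof.
move=> [l1 l2 neg s1 s2 t1 t2 n1 n2].
have E1 : (fun x => Re (c%:C * g x)) = (fun x => c * Re (g x)).
  by apply/funext => x; case: (g x) => a b /=; ring.
have E2 : (fun x => Im (c%:C * g x)) = (fun x => c * Im (g x)).
  by apply/funext => x; case: (g x) => a b /=; ring.
split; rewrite ?E1 ?E2.
- exact: lacZ.
- exact: lacZ.
- by move=> x /neg ->; rewrite mulr0.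
- exact: sq_intZ.
- exact: sq_intZ.
- exact: sq_int_derive1Z.
- exact: sq_int_derive1Z.
- by apply: sq_int_eq (sq_intZ c n1) => x _;
  rewrite -[Re (c%:C * g x)]/((fun x => Re (c%:C * g x)) x) E1; ring.
- by apply: sq_int_eq (sq_intZ c n2) => x _;
  rewrite -[Im (c%:C * g x)]/((fun x => Im (c%:C * g x)) x) E2; ring.
Qed.

Lemma Rintegral_sqr_eq0 w : sq_int w -> \int[lam]_(x in posR) w x ^+ 2 = 0 ->
  {ae lam, forall x, posR x -> w x = 0}.
Proof.
move=> [mw iw] w0.
have mw2 : measurable_fun posR (fun x => (w x ^+ 2)%:E) by exact: measurable_int iw.
have : (\int[lam]_(x in posR) `|(w x ^+ 2)%:E| = 0)%E.
  under eq_integral do rewrite gee0_abs ?lee_fin ?sqr_ge0 //.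
  by rewrite -EFin_Rintegral // w0.
move=> /(ae_eq_integral_abs lam measurable_posR_sigma mw2).
by apply: ae_imp => x H /H [] /eqP; rewrite sqrf_eq0 => /eqP.
Qed.

Lemma ae_neq0 : {ae lam, forall x : R, x != 0}.
Proof.
exists [set 0]; split; [exact: measurable_set1|exact: lebesgue_measure_set1|].
by move=> x /= /negP; rewrite negbK => /eqP.
Qed.

Lemma nonzero_norm f : regular_pair f -> nonzero_signal f -> 0 < norm2 f.
Proof.
move=> rf nz; have [l1 l2 neg s1 s2 _ _ _ _] := rf.
rewrite lt_def sqrtr_ge0 andbT; apply/eqP => N0; apply: nz.
have := norm2_sqr f; rewrite N0 expr0n => /esym.
rewrite (RintegralD measurable_posR_sigma (proj2 s1) (proj2 s2)) => /eqP.
have p1 : 0 <= \int[lam]_(x in posR) Re (f x) ^+ 2 by apply: Rintegral_ge0 => x _; exact: sqr_ge0.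
have p2 : 0 <= \int[lam]_(x in posR) Im (f x) ^+ 2 by apply: Rintegral_ge0 => x _; exact: sqr_ge0.
rewrite paddr_eq0 // => /andP[/eqP e1 /eqP e2].
apply: ae_imp2 (Rintegral_sqr_eq0 s1 e1) (Rintegral_sqr_eq0 s2 e2) => x h1 h2.
have [x0|x0] := leP x 0; first exact: neg.
have xp : posR x by rewrite posRE.
by move: (h1 xp) (h2 xp); case: (f x) => a b /= -> ->.
Qed.

(** Passing to the modulus and dilating turns any signal into a normalized
    real competitor that is at least as good. *)
Lemma signal_competitor f : dom_LS f -> nonzero_signal f ->
  exists u phi, admissible u phi /\ energy u phi <= LS f.
Proof.
move=> df nz; have rf := dom_LS_regular df; have N0 := nonzero_norm rf nz.
have rg := regular_pairZ (norm2 f)^-1 rf; rewrite -/(normalize f) in rg.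
have [_ _ _ s1 s2 _ _ _ _] := rf.
have g1 : \int[lam]_(x in posR) (Re (normalize f x) ^+ 2 + Im (normalize f x) ^+ 2) = 1.
  transitivity ((norm2 f) ^- 2 * norm2 f ^+ 2); last by rewrite mulVf // expf_neq0 // gt_eqF.
  rewrite [X in _ * X]norm2_sqr -RintegralZl //; last first.
    exact: (integrable_realD measurable_posR (proj2 s1) (proj2 s2)).
  apply: eq_Rintegral => x _; rewrite /normalize -exprVn.
  by case: (f x) => a b /=; ring.
have [v [psi [hv mE kE sE]]] := modulus_pair rg g1.
have [u [phi [au eE]]] := dilate hv.
exists u, phi; split => //; rewrite eE /LS -sE lerD2r mE.
rewrite (_ : -2 * _ = 2 * - Re (mean (@Tsigma R) (normalize f))); last by ring.
by rewrite ler_pM2l // expR_gt0.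
Qed.

Section RealSignal.
Variable u : R -> R.
Hypotheses (lu : lac u) (neg : forall x, x <= 0 -> u x = 0) (su : sq_int u)
  (sd : sq_int (derive1 u)) (sl : sq_int (fun x => ln x * u x))
  (u1 : \int[lam]_(x in posR) u x ^+ 2 = 1) (um : log_mean u = 0).

Definition real_signal (x : R) : R[i] := (u x)%:C.

Lemma memL2_real (w : R -> R) : measurable_fun [set: R] w ->
  (forall x, x < 0 -> w x = 0) -> sq_int w ->
  (\int[lam]_x (w x ^+ 2)%:E < +oo)%E.
Proof.
move=> mw w0 sw; have /(sq_intP (proj1 sw)) := sw.
rewrite integral_mkcond; apply: le_lt_trans; rewrite le_eqVlt; apply/orP; left; apply/eqP.
have mw2 : measurable_fun [set: R] (fun x => (w x ^+ 2)%:E).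
  by apply/measurable_EFinP; exact: measurable_funX.
apply: ge0_ae_eq_integral => //.
- apply: (measurable_restrictT _ measurable_posR).1; exact: measurable_funTS.
- by move=> x _; rewrite lee_fin sqr_ge0.
- by move=> x _; rewrite patchE; case: ifP => // _; rewrite lee_fin sqr_ge0.
apply: ae_imp ae_neq0 => x x0 _; rewrite patchE; case: ifPn => //.
rewrite notin_setE /= posRE => /negP; rewrite -leNgt => xle.
by rewrite w0 ?expr0n // lt_neqAle x0.
Qed.

Lemma derive1_neg x : x < 0 -> derive1 u x = 0.
Proof.
move=> x0; apply: derive1_near0.
by apply: filterS (lt_nbhsl x0) => y y0; rewrite neg // ltW.
Qed.

Lemma Re_real_signal : (fun x => Re (real_signal x)) = u.
Proof. by []. Qed.

Lemma Im_real_signal : (fun x => Im (real_signal x)) = (fun=> 0).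
Proof. by []. Qed.

Lemma derive1_zero : derive1 (fun _ : R => (0 : R)) = (fun=> 0).
Proof. by apply/funext => x; apply: derive1_near0; near=> y.
Unshelve. all: by end_near. Qed.

Lemma memL2_real_signal (w : R -> R) f : measurable_fun [set: R] w ->
  (forall x, x < 0 -> w x = 0) -> sq_int w ->
  (forall x, f x = (w x)%:C) -> memL2 f.
Proof.
move=> mw w0 sw fE; rewrite (_ : f = fun x => (w x)%:C); last exact/funext.
split => //=.
have -> : (\int[lam]_x (cmod (w x)%:C ^+ 2)%:E = \int[lam]_x (w x ^+ 2)%:E)%E;
  last exact: memL2_real.
by apply: eq_integral => x _; rewrite cmod_real real_normK // num_real.
Qed.

Lemma abs_cont_on_of_lac a b : abs_cont_on a b real_signal.
Proof.
have acb : ac (u \o clamp a (Num.max a b + 1)).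
  by apply: lu; rewrite (le_lt_trans (_ : a <= Num.max a b)) ?le_max ?lexx // ltrDl.
move=> e /(abs_cont_on_of_ac a b acb)[d d0 H]; exists d => // n s t st disj len.
have := H n s t st disj len; congr (_ < _); apply: eq_bigr => i _.
have [as_ sti tb] := st i.
have bm : b <= Num.max a b + 1.
  by rewrite (le_trans (_ : b <= Num.max a b)) ?le_max ?lexx ?orbT // lerDl.
by rewrite /real_signal /= !clamp_id //; lra.
Qed.

Lemma real_signal_dom : dom_LS real_signal.
Proof.
have nneg x : x < 0 -> real_signal x = 0 by move=> x0; rewrite /real_signal neg // ltW.
have uneg x : x < 0 -> u x = 0 by move=> x0; rewrite neg // ltW.
have sig : signal real_signal.
  split => //; apply: (memL2_real_signal _ uneg su) => //; exact: measurable_lac.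
split; split => //.
- by move=> a b _; exact: abs_cont_on_of_lac.
- apply: (memL2_real_signal _ derive1_neg sd); first exact: measurable_derive1_lac.
  by move=> x; rewrite /cderiv Re_real_signal Im_real_signal derive1_zero.
- split; last by move=> x /nneg ->; rewrite mulr0.
  apply: (memL2_real_signal (w := fun x => ln x * u x)) => //.
  + by apply: measurable_funM; [exact: measurable_ln|exact: measurable_lac].
  + by move=> x /uneg ->; rewrite mulr0.
  + by move=> x; rewrite /real_signal -rmorphM.
Qed.

Lemma real_signal_nonzero : nonzero_signal real_signal.
Proof.
move=> H; have : \int[lam]_(x in posR) u x ^+ 2 = \int[lam]_(x in posR) 0.
  apply: ae_eq_Rintegral => //.
    by apply: measurable_funX; exact: measurable_lac.
  by apply: ae_imp H => x [] ->; rewrite expr0n.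
rewrite u1 Rintegral_cst // mul0r => /eqP.
by rewrite oner_eq0.
Qed.

(** A real signal has mean frequency [0], so its variance for [Tx] is its kinetic
    energy; the dilation factor is [1] because the logarithmic mean is [0]. *)
Lemma LS_real_signal : LS real_signal = energy u (derive1 u).
Proof.
have rg := dom_LS_regular real_signal_dom.
have n1 : norm2 real_signal = 1.
  apply/eqP; rewrite -(@eqrXn2 _ 2) ?sqrtr_ge0 // expr1n norm2_sqr -u1; apply/eqP.
  by apply: eq_Rintegral => x _ /=; rewrite expr0n addr0.
have nE : normalize real_signal = real_signal.
  by apply/funext => x; rewrite /normalize n1 invr1 mul1r.
have mE : \int[lam]_(x in posR) (ln x * (u x ^+ 2 + 0 ^+ 2)) = 0.
  by rewrite -[RHS]um; apply: eq_Rintegral => x _; rewrite expr0n addr0.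
have freq : frequency real_signal = 0.
  rewrite /frequency Re_real_signal Im_real_signal derive1_zero.
  under eq_Rintegral do rewrite /= mulr0 mul0r subrr.
  by rewrite Rintegral_cst // mul0r.
rewrite /LS nE mean_TsigmaE // variance_TxE // variance_TsigmaE // freq.
rewrite /= mE oppr0 mulr0 expR0 mul1r /energy; congr (_ + _).
  apply: eq_Rintegral => x _; rewrite Re_real_signal Im_real_signal derive1_zero.
  by rewrite !mul0r addr0 subr0 expr0n add0r.
by apply: eq_Rintegral => x _; rewrite addr0 expr0n addr0 exprMn.
Qed.

End RealSignal.

End Signals.

(** * Equicontinuity from bounded energy *)

Section Compactness.
Context {R : realType}.
Implicit Types (f g u v phi : R -> R) (l : seq (R * R)).
Local Notation lam := (@lebesgue_measure R).
Local Notation posR := (@posR R).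

Lemma sum_integral_family g l : (forall x, posR x -> 0 <= g x) ->
  lam.-integrable posR (EFin \o g) -> increment_family l ->
  all (fun p => 0 <= p.1) l ->
  \sum_(p <- l) \int[lam]_(x in `]p.1, p.2]) g x <= \int[lam]_(x in posR) g x.
Proof.
move=> g0 gi fl l0.
have sub l' : all (fun p => 0 <= p.1) l' -> family_cover l' `<=` posR.
  move=> l'0 x /family_coverP[p /(allP l'0) p0 /andP[px _]].
  by rewrite posRE (le_lt_trans p0).
have mc l' : measurable (family_cover l' : set R) by exact: measurable_family_cover.
suff -> : \sum_(p <- l) \int[lam]_(x in `]p.1, p.2]) g x = \int[lam]_(x in family_cover l) g x.
  by apply: le_Rintegral_subset => //; exact: sub.
elim: l fl l0 => [|p l IH] fl; first by rewrite big_nil /family_cover big_nil Rintegral_set0.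
move=> /andP[p0 l0]; have fl' : increment_family l.
  by move: fl; rewrite /increment_family => /andP[/= /andP[_ ->] /andP[_ ->]].
rewrite big_cons IH // /family_cover big_cons -/(family_cover l) Rintegral_setU //.
- exact: mc.
- apply: integrableS gi => //; first by apply: measurableU => //; exact: mc.
  move=> x [|/sub]; last exact.
  by rewrite /= in_itv /= posRE => /andP[+ _]; exact: le_lt_trans.
- by apply/disj_set2P/family_cover_disjoint.
Qed.

(** Uniform modulus of absolute continuity for bounded kinetic energy, obtained by
    integrating [|phi| <= 1 / (2 c) + c phi ^ 2 / 2]. Being linear in both sums, it
    passes to pointwise limits, and [c] is chosen at the end. *)
Lemma hlf_modulus u phi (C c : R) l : half_line_function u phi -> kinetic phi <= C ->
  0 < c -> increment_family l ->
  \sum_(p <- l) `|u p.2 - u p.1| <= (\sum_(p <- l) (p.2 - p.1)) / (2 * c) + c * C / 2.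
Proof.
move=> [neg ftc int [mphi sphi] su sl u1] kC c0 fl.
pose l' := map_family (Num.max 0) l.
have mono (x y : R) : x <= y -> Num.max 0 x <= Num.max 0 y.
  by move=> xy; rewrite !maxEle; case: (leP 0 x); case: (leP 0 y) => * /=; try lra.
have lip (x y : R) : x <= y -> Num.max 0 y - Num.max 0 x <= y - x.
  by move=> xy; rewrite !maxEle; case: (leP 0 x); case: (leP 0 y) => * /=; try lra.
have [fl' len] := map_family_contraction mono lip fl; rewrite -/l' in fl' len.
have umax x : u x = u (Num.max 0 x).
  by rewrite maxEle; case: (leP 0 x) => // x0; rewrite !neg // ltW.
have -> : \sum_(p <- l) `|u p.2 - u p.1| = \sum_(p <- l') `|u p.2 - u p.1|.
  by rewrite big_map; apply: eq_bigr => p _ /=; rewrite -!umax.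
have l'0 : all (fun p => 0 <= p.1) l'.
  by apply/allP => _ /mapP[p _ ->] /=; rewrite le_max lexx.
apply: (@le_trans _ _ (\sum_(p <- l') ((p.2 - p.1) / (2 * c) +
   c / 2 * \int[lam]_(x in `]p.1, p.2]) (phi x ^+ 2)))); last first.
  rewrite big_split /= -mulr_suml -mulr_sumr; apply: lerD.
    by rewrite ler_pM2r // invr_gt0 mulr_gt0.
  rewrite [leRHS]mulrAC ler_pM2l ?divr_gt0 //; apply: le_trans kC.
  by apply: sum_integral_family => // x _; exact: sqr_ge0.
rewrite big_seq [leRHS]big_seq; apply: ler_sum => p pl.
have p0 : 0 <= p.1 by exact: (allP l'0).
have p12 : p.1 <= p.2 by case/andP: fl' => /allP/(_ _ pl).
have mI : measurable (`]p.1, p.2]%classic : set R) by exact: measurable_itv.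
have sub : `]p.1, p.2]%classic `<=` posR.
  by move=> x /=; rewrite in_itv /= posRE => /andP[+ _]; exact: le_lt_trans.
have iphi : lam.-integrable `]p.1, p.2] (EFin \o phi).
  by apply: integrableS (int _ _ p0 p12) => // x /=; rewrite !in_itv /= => /andP[/ltW -> ->].
have iphi2 : lam.-integrable `]p.1, p.2] (EFin \o (fun x => phi x ^+ 2)).
  exact: integrableS sphi.
have lI : (lam `]p.1, p.2]%classic < +oo)%E by rewrite [X in (X < _)%E](@lebesgue_ocitv R) // ltry.
rewrite ftc // -Rintegral_itv_obnd_cbnd //.
apply: le_trans (le_normr_Rintegral _ iphi) _ => //.
have ic : lam.-integrable `]p.1, p.2] (EFin \o (fun=> (2 * c)^-1)) by exact: integrable_cst_real.
have isq : lam.-integrable `]p.1, p.2] (EFin \o (fun x => c / 2 * phi x ^+ 2))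
  by exact: integrable_realZ.
rewrite -RintegralZl // (_ : (p.2 - p.1) / (2 * c) = \int[lam]_(x in `]p.1, p.2]) (2 * c)^-1);
  last first.
  by rewrite Rintegral_cst // [X in fine X](@lebesgue_ocitv R) //= mulrC.
rewrite -RintegralD //; apply: le_Rintegral => //.
- exact: integrable_norm iphi.
- exact: integrable_realD.
- move=> x _; have c20 : 0 < 2 * c by rewrite mulr_gt0.
  rewrite -(real_normK (num_real (phi x))) -(ler_pM2l c20) mulrDr mulfV ?gt_eqF //.
  by have := sqr_ge0 (c * `|phi x| - 1); rewrite expr2; nra.
Qed.

Lemma ac_of_modulus u (C : R) : 0 <= C ->
  (forall (c : R) l, 0 < c -> increment_family l ->
    \sum_(p <- l) `|u p.2 - u p.1| <= (\sum_(p <- l) (p.2 - p.1)) / (2 * c) + c * C / 2) ->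
  ac u.
Proof.
move=> C_ge0 H e e0; pose K := C + 1.
have K0 : 0 < K by rewrite /K; lra.
pose c := e / (2 * K).
have c0 : 0 < c by rewrite divr_gt0 // mulr_gt0.
exists (c * e) => [|l fl len]; first exact: mulr_gt0.
apply: le_lt_trans (H _ _ c0 fl) _.
have : c * C / 2 <= e / 4.
  (* [c] is chosen to make the second term of the modulus at most [e / 4]. *)
  rewrite (_ : e / 4 = c * K / 2); last by rewrite /c; field; rewrite gt_eqF.
  by rewrite ler_pM2r ?invr_gt0 // ler_pM2l // /K; lra.
have : (\sum_(p <- l) (p.2 - p.1)) / (2 * c) < e / 2.
  have c20 : 0 < 2 * c by apply: mulr_gt0.
  rewrite ltr_pdivrMr //; apply: lt_le_trans len _.
  by rewrite mulrA divfK // mulrC.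
lra.
Qed.

Lemma kinetic_ge0 phi : 0 <= kinetic phi.
Proof. by apply: Rintegral_ge0 => x _; exact: sqr_ge0. Qed.

Lemma log_second_ge0 u : 0 <= log_second u.
Proof. by apply: Rintegral_ge0 => x _; exact: sqr_ge0. Qed.

Lemma hlf_ac u phi : half_line_function u phi -> ac u.
Proof.
by move=> hu; apply: (ac_of_modulus (kinetic_ge0 phi)) => c l c0 fl;
  exact: hlf_modulus hu (lexx _) c0 fl.
Qed.

Lemma hlf_increment u phi (C c x y : R) : half_line_function u phi ->
  kinetic phi <= C -> 0 < c -> `|u y - u x| <= `|y - x| / (2 * c) + c * C / 2.
Proof.
move=> hu kC c0; have key (a b : R) : a <= b -> `|u b - u a| <= `|b - a| / (2 * c) + c * C / 2.
  move=> ab; have ab0 : 0 <= b - a by rewrite subr_ge0.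
  have fam : increment_family [:: (a, b)] by rewrite /increment_family /= ab.
  by have := hlf_modulus hu kC c0 fam; rewrite !big_seq1 /= (ger0_norm ab0).
have [xy|/ltW yx] := leP x y; first exact: key.
by rewrite (distrC (u y)) (distrC y); exact: key.
Qed.

Lemma hlf_bound u phi (C x : R) : half_line_function u phi -> kinetic phi <= C ->
  0 <= x -> `|u x| <= (x + C) / 2.
Proof.
move=> hu kC x0; have := hlf_increment 0 x hu kC ltr01.
by rewrite (hlf_neg hu (lexx 0)) !subr0 mulr1 mul1r mulrDl (ger0_norm x0).
Qed.

Lemma hlf_equicontinuous (U Phi : nat -> R -> R) (C : R) :
  (forall n, half_line_function (U n) (Phi n)) -> (forall n, kinetic (Phi n) <= C) ->
  forall e, 0 < e ->
  exists2 d : R, 0 < d & forall n x y, `|x - y| < d -> `|U n x - U n y| <= e.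
Proof.
move=> hU kC e e0; have C0 : 0 <= C by apply: le_trans (kinetic_ge0 _) (kC 0%N).
pose K := C + 1; have K0 : 0 < K by rewrite /K; lra.
pose c := e / K; have c0 : 0 < c by rewrite divr_gt0.
exists (c * e) => [|n x y xy]; first exact: mulr_gt0.
apply: le_trans (hlf_increment y x (hU n) (kC n) c0) _.
rewrite [leRHS]splitr; apply: lerD.
  have c20 : 0 < 2 * c by apply: mulr_gt0.
  rewrite ler_pdivrMr //; apply: le_trans (ltW xy) _.
  by rewrite mulrA divfK // mulrC.
rewrite ler_pM2r ?invr_gt0 //.
rewrite (_ : e = c * K); last by rewrite /c divfK // gt_eqF.
by rewrite ler_pM2l // /K; lra.
Qed.

End Compactness.

(** * Pointwise convergent subsequences *)

Section Subsequence.
Context {R : realType}.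
Implicit Types (f g u v phi : R -> R) (l : seq (R * R)).
Local Notation lam := (@lebesgue_measure R).
Local Notation posR := (@posR R).

(** By Tychonoff's theorem the sequence has a cluster point in the product
    topology, whose neighbourhoods constrain finitely many values at a time. *)
Lemma cluster_function (U : nat -> R -> R) (M : R -> R) :
  (forall n x, `|U n x| <= M x) ->
  exists v : R -> R, forall (s : seq R) (e : R), 0 < e ->
    forall N, exists2 n, (N <= n)%N & forall x, x \in s -> `|U n x - v x| < e.
Proof.
move=> UM.
pose K (x : R) : set R := `[- M x, M x]%classic.
have cKx x : compact (K x) by exact: segment_compact.
have cK := @tychonoff R (fun=> R : topologicalType) K cKx.
have [|v [_ clv]] := cK (U @ \oo) (fmap_proper_filter U _).
  by exists 0%N => // n _ x; rewrite /K /= in_itv /= -ler_norml.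
exists v => s e e0 N.
pose PT : topologicalType := prod_topology (fun _ : R => (R : topologicalType)).
have FF : Filter (nbhs (v : PT)) := nbhs_filter (v : PT).
have nb : nbhs (v : PT) [set g : PT | forall x, x \in s -> `|(g : R -> R) x - v x| < e].
  elim: s => [|y s IH].
    by rewrite (_ : [set g | _] = setT); [exact: (@filterT _ _ FF)|apply/seteqP; split].
  have ny : nbhs (v : PT) [set g : PT | `|(g : R -> R) y - v y| < e].
    apply: (@proj_continuous R (fun=> R : topologicalType) y v [set z | `|z - v y| < e]).
    apply/nbhs_ballP; exists e => // z; rewrite /ball /=.
    by rewrite distrC.
  apply: (@filterS _ _ FF _ _ _ (@filterI _ _ FF _ _ ny IH)) => g [gy gs] x.
  rewrite inE => /orP[/eqP->//|].
  exact: gs.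
have FN : (U @ \oo) (U @` [set n | (N <= n)%N]).
  by exists N => // n /= Nn; exists n.
have [g [[n /= Nn <-] gs]] := clv _ _ FN nb.
by exists n.
Qed.

Definition equicontinuous_family (U : nat -> R -> R) := forall e, 0 < e ->
  exists2 d : R, 0 < d & forall n x y, `|x - y| < d -> `|U n x - U n y| <= e.

(** An equicontinuous pointwise bounded sequence of functions on the line has a
    pointwise convergent subsequence: a cluster point for the product topology is
    approximated on finer and finer grids, and equicontinuity fills the gaps. *)
Lemma pointwise_subsequence (U : nat -> R -> R) (M : R -> R) :
  (forall n x, `|U n x| <= M x) -> equicontinuous_family U ->
  exists (v : R -> R) (sigma : nat -> nat), (forall k, (k <= sigma k)%N) /\
    forall x, U (sigma k) x @[k --> \oo] --> v x.
Proof.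
move=> UM eqU; have [v vP] := cluster_function UM.
have eqv e : 0 < e -> exists2 d : R, 0 < d & forall x y, `|x - y| < d -> `|v x - v y| <= e.
  move=> e0; have [d d0 H] := eqU e e0; exists d => // x y /H {}H.
  apply/ler_addgt0Pr => r r0; have r20 : 0 < r / 2 by rewrite divr_gt0.
  have [n _ nP] := vP [:: x; y] _ r20 0%N.
  have := nP x; have := nP y; rewrite !inE !eqxx orbT => /(_ isT) ny /(_ isT) nx.
  have Hn := H n; rewrite (_ : v x - v y = - (U n x - v x) + (U n y - v y) + (U n x - U n y));
    last by ring.
  apply: le_trans (ler_normD _ _) _; rewrite addrC; apply: lerD => //.
  apply: le_trans (ler_normD _ _) _; rewrite normrN [r]splitr.
  by apply: lerD; exact: ltW.
pose grid k : seq R := [seq grid_point k j | j <- iota 0 (k.+1 * k.+1).*2.+1].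
have /choice[sigma sP] : forall k, exists n, (k <= n)%N /\
    forall x, x \in grid k -> `|U n x - v x| < k.+1%:R^-1.
  move=> k; have [|n kn nP] := vP (grid k) k.+1%:R^-1 _ k; first by rewrite invr_gt0 ltr0n.
  by exists n.
exists v, sigma; split=> [k|x]; first by have [] := sP k.
apply/cvgrPdist_le => e e0; have e30 : 0 < e / 3 by rewrite divr_gt0.
have [d1 d10 H1] := eqU _ e30; have [d2 d20 H2] := eqv _ e30.
pose d := Num.min d1 d2; have d0 : 0 < d by rewrite lt_min d10.
near=> k.
have ke : k.+1%:R^-1 < e / 3.
  rewrite -[e / 3]invrK ltf_pV2 ?posrE ?invr_gt0 ?ltr0n //.
  by near: k; exact: near_infty_gtS.
have : family_cover (grid_cells (ball x d) k) x.
  near: k; apply: grid_cells_exhaust; first exact: ball_open.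
  exact: ballxx.
move=> /family_coverP[p /mapP[j]]; rewrite mem_filter => /andP[/asboolP jB jI] -> /= /andP[px xp].
set y := grid_point k j.+1 in jB xp *.
have yd : `|x - y| < d.
  by apply: (jB y); rewrite /= in_itv /= lexx andbT (lt_le_trans px).
have yg : y \in grid k.
  apply/mapP; exists j.+1 => //.
  by move: jI; rewrite !mem_iota !add0n /= ltnS.
have [_ /(_ _ yg) Uy] := sP k.
have [yd1 yd2] : `|x - y| < d1 /\ `|x - y| < d2 by move: yd; rewrite lt_min => /andP.
have h1 := H1 (sigma k) _ _ yd1; have h2 := H2 _ _ yd2.
rewrite (_ : v x - U (sigma k) x =
  (v x - v y) - (U (sigma k) x - U (sigma k) y) - (U (sigma k) y - v y)); last by ring.
apply: le_trans (ler_normB _ _) _.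
apply: le_trans (lerD (ler_normB _ _) (lexx _)) _.
have := lerD (lerD h2 h1) (ltW (lt_trans Uy ke)).
by rewrite (_ : e / 3 + e / 3 + e / 3 = e) //; field.
Unshelve. all: by end_near. Qed.

End Subsequence.

(** * Difference quotients and kinetic energy *)

Section Quotient.
Context {R : realType}.
Implicit Types (f g u v phi : R -> R) (l : seq (R * R)).
Local Notation lam := (@lebesgue_measure R).
Local Notation posR := (@posR R).

(** Expand the integral of [(phi - c) ^ 2] for [c] the mean value of [phi]. *)
Lemma mean_sqr_le (a b : R) phi : a < b -> lam.-integrable `[a, b] (EFin \o phi) ->
  lam.-integrable `[a, b] (EFin \o (fun x => phi x ^+ 2)) ->
  (\int[lam]_(x in `[a, b]) phi x) ^+ 2 <=
  (b - a) * \int[lam]_(x in `[a, b]) phi x ^+ 2.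
Proof.
move=> ab i1 i2; have ab0 : 0 < b - a by rewrite subr_gt0.
have mI : measurable (`[a, b]%classic : set R) by exact: measurable_itv.
have lI : lam `[a, b]%classic = (b - a)%:E.
  by rewrite lebesgue_measure_itv /= lte_fin ab EFinB.
set A := \int[lam]_(x in `[a, b]) phi x; set B := \int[lam]_(x in `[a, b]) phi x ^+ 2.
pose c := A / (b - a).
have : 0 <= \int[lam]_(x in `[a, b]) (phi x - c) ^+ 2.
  by apply: Rintegral_ge0 => x _; exact: sqr_ge0.
have ic : lam.-integrable `[a, b] (EFin \o (fun=> c ^+ 2)).
  by apply: integrable_cst_real => //; rewrite lI ltry.
have i1' : lam.-integrable `[a, b] (EFin \o (fun x => - (2 * c) * phi x))
  by exact: integrable_realZ.
have -> : \int[lam]_(x in `[a, b]) (phi x - c) ^+ 2 =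
    \int[lam]_(x in `[a, b]) (phi x ^+ 2 + - (2 * c) * phi x + c ^+ 2).
  by apply: eq_Rintegral => x _; ring.
rewrite RintegralD //; last exact: integrable_realD.
rewrite RintegralD // RintegralZl // Rintegral_cst // [X in fine X]lI /= -/A -/B.
rewrite -(ler_pM2l ab0) mulr0 => H; rewrite -subr_ge0.
suff -> : (b - a) * B - A ^+ 2 =
  (b - a) * (B + - (2 * c) * A + c ^+ 2 * (b - a)) by [].
by rewrite /c; field; rewrite gt_eqF.
Qed.

(** Difference quotients are controlled by the kinetic energy: apply
    Cauchy-Schwarz on [[x, x + h]] and exchange the order of integration. *)
Lemma hlf_quotient u phi (h : R) : half_line_function u phi -> 0 < h ->
  (\int[lam]_(x in posR) (slope u x h ^+ 2)%:E <= (kinetic phi)%:E)%E.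
Proof.
move=> hu h0; have [neg ftc int [mphi sphi] su sl u1] := hu.
have cu : continuous u by apply: ac_continuous; exact: hlf_ac hu.
pose P y := if y \in posR then phi y ^+ 2 else 0.
have P0 y : 0 <= P y by rewrite /P; case: ifP => // _; exact: sqr_ge0.
have mP : measurable_fun [set: R] P.
  rewrite (_ : P = (fun x => phi x ^+ 2) \_ posR); last by apply/funext => y; rewrite patchE.
  by apply: (measurable_restrictT _ measurable_posR).1; exact: measurable_funX.
pose A : set (R * R) := [set z | 0 < z.1 /\ (0 <= z.2 - z.1 <= h)].
have mA : measurable A.
  rewrite (_ : A = (fst @^-1` posR) `&` ((fun z : R * R => z.2 - z.1) @^-1` `[0, h]%classic)).
    apply: measurableI.
      rewrite -[X in measurable X]setTI.
      exact: (@measurable_fst _ _ R R measurableT _ measurable_posR).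
    have mB : measurable_fun [set: R * R] (fun z : R * R => z.2 - z.1) by exact: measurable_funB.
    by rewrite -[X in measurable X]setTI; exact: (mB measurableT _ (measurable_itv _)).
  by apply/seteqP; split => z /=; rewrite posRE in_itv.
pose F (z : R * R) : \bar R := (\1_A z * P z.2)%:E.
have mF : measurable_fun [set: R * R] F.
  apply/measurable_EFinP; apply: measurable_funM; first exact: measurable_indic.
  exact: measurableT_comp mP measurable_snd.
have F0 z : (0 <= F z)%E by rewrite lee_fin mulr_ge0.
have step1 x : posR x -> ((slope u x h ^+ 2)%:E <= (h^-1)%:E * \int[lam]_y F (x, y))%E.
  rewrite posRE => x0.
  have xh : x < h + x by rewrite ltrDr.
  have iphi := int _ _ (ltW x0) (ltW xh).
  have sub : `[x, h + x]%classic `<=` posR.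
    by move=> y /=; rewrite in_itv /= posRE => /andP[xy _]; exact: lt_le_trans xy.
  have iphi2 : lam.-integrable `[x, h + x] (EFin \o (fun y => phi y ^+ 2))
    by exact: integrableS sphi.
  have -> : (\int[lam]_y F (x, y) = \int[lam]_(y in `[x, (h + x)%R]) (phi y ^+ 2)%:E)%E.
    rewrite [RHS]integral_mkcond; apply: eq_integral => y _; rewrite patchE /F.
    rewrite indicE; case: ifPn.
      rewrite inE /= in_itv /= => /andP[xy yx]; rewrite mem_set.
        by rewrite mul1r /P mem_set //; apply: sub; rewrite /= in_itv /= xy.
      by split => //=; apply/andP; split; lra.
    rewrite notin_setE /= in_itv /= => /negP nI; rewrite memNset ?mul0r //.
    move=> [_ /= /andP[q1 q2]]; move: nI; apply/negP; rewrite negbK.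
    by apply/andP; split; lra.
  rewrite -EFin_Rintegral // -EFinM lee_fin.
  have := mean_sqr_le xh iphi iphi2; rewrite -ftc ?(ltW x0) ?(ltW xh) // addrK => H.
  rewrite /slope exprMn expr2 -mulrA ler_pM2l ?invr_gt0 //.
  by rewrite ler_pdivrMl.
have mslope : measurable_fun posR (fun x => (slope u x h ^+ 2)%:E).
  apply/measurable_EFinP; apply: measurable_funX; apply: measurable_funM => //.
  apply: measurable_funB; last by apply: measurable_funTS; exact: continuous_measurable_fun.
  apply: measurable_funTS; apply: measurableT_comp.
    exact: continuous_measurable_fun.
  exact: measurable_funD.
have mG : measurable_fun [set: R] (fun x => \int[lam]_y F (x, y))%E.
  exact: (@measurable_fun_fubini_tonelli_F _ _ R _ _ lam F mF F0).
have hV0 : 0 <= h^-1 by rewrite invr_ge0 ltW.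
apply: (@le_trans _ _ (\int[lam]_(x in posR) ((h^-1)%:E * \int[lam]_y F (x, y)))%E).
  apply: ge0_le_integral => //.
  - by move=> x _; rewrite lee_fin sqr_ge0.
  - by apply: measurable_funTS; exact: emeasurable_funM.
rewrite ge0_integralZl //; [|exact: measurable_funTS|by move=> x _; exact: integral_ge0].
rewrite -(@lee_pmul2l _ h%:E) ?lte_fin // muleA -EFinM mulfV ?gt_eqF // mul1e.
apply: (@le_trans _ _ (\int[lam]_x \int[lam]_y F (x, y))%E).
  by apply: ge0_subset_integral => // x _; exact: integral_ge0.
rewrite (@fubini_tonelli _ _ _ _ _ lam lam F mF F0).
apply: (@le_trans _ _ (\int[lam]_y (h%:E * (P y)%:E))%E).
  apply: ge0_le_integral => //.
  - by move=> y _; apply: integral_ge0.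
  - exact: (@measurable_fun_fubini_tonelli_G _ _ _ R _ lam F mF F0).
  - by apply: emeasurable_funM => //; exact/measurable_EFinP.
  move=> y _; rewrite /F /=.
  apply: (@le_trans _ _ (\int[lam]_x ((P y)%:E * (\1_(`[y - h, y]%classic : set R) x)%:E))%E).
    apply: ge0_le_integral => //.
    - by move=> x _; rewrite lee_fin mulr_ge0.
    - exact: (measurable_fun_pair1 y mF).
    - apply: emeasurable_funM => //; apply/measurable_EFinP; exact: measurable_indic.
    - move=> x _; rewrite -EFinM lee_fin mulrC ler_wpM2l // !indicE.
      case: (boolP ((x, y) \in A)) => //; rewrite inE => -[_ /= /andP[q1 q2]].
      by rewrite mem_set //= in_itv /=; apply/andP; split; lra.
  rewrite ge0_integralZl //; first last.
  - by rewrite lee_fin.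
  - by apply/measurable_EFinP; exact: measurable_indic.
  have lI : lam `[y - h, y]%classic = h%:E.
    rewrite lebesgue_measure_itv /= lte_fin ltrBlDr ltrDl h0.
    by rewrite -EFinB opprB addrC subrK.
  by rewrite integral_indic // setIT [X in (_ * X <= _)%E]lI muleC.
rewrite ge0_integralZl //; first last.
- by rewrite lee_fin ltW.
- by move=> y _; rewrite lee_fin.
- exact/measurable_EFinP.
rewrite /kinetic EFin_Rintegral // [X in (_ <= _ * X)%E]integral_mkcond lee_pmul2l ?lte_fin //.
rewrite le_eqVlt; apply/orP; left; apply/eqP; apply: eq_integral => y _.
by rewrite patchE /P; case: ifP.
Qed.

End Quotient.

(** * The limit of a minimizing sequence *)

Section Limit.
Context {R : realType}.
Implicit Types (f g u phi : R -> R) (l : seq (R * R)).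
Local Notation lam := (@lebesgue_measure R).
Local Notation posR := (@posR R).

Variables (V Phi : nat -> R -> R) (v : R -> R) (C I : R).
Hypotheses (adm : forall n, admissible (V n) (Phi n))
  (energy_le : forall n, energy (V n) (Phi n) <= C)
  (energy_lim : forall e, 0 < e -> \forall n \near \oo, energy (V n) (Phi n) <= I + e)
  (Vv : forall x, V n x @[n --> \oo] --> v x).

Let hlf n : half_line_function (V n) (Phi n) := proj1 (adm n).

Let kC n : kinetic (Phi n) <= C.
Proof. by apply: le_trans (energy_le n); rewrite lerDl log_second_ge0. Qed.

Let lC n : log_second (V n) <= C.
Proof. by apply: le_trans (energy_le n); rewrite lerDr kinetic_ge0. Qed.

Let C0 : 0 <= C := le_trans (kinetic_ge0 _) (kC 0).

Let vneg x : x <= 0 -> v x = 0.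
Proof.
move=> x0; rewrite -(cvg_lim _ (@Vv x)) //.
rewrite (_ : (fun n => V n x) = fun=> 0); first by rewrite lim_cst.
by apply/funext => n; apply: hlf_neg (hlf n) _ x0.
Qed.

Lemma cvg_sum_seq (T : Type) (F : nat -> T -> R) (G : T -> R) (s : seq T) :
  (forall p, F n p @[n --> \oo] --> G p) ->
  \sum_(p <- s) F n p @[n --> \oo] --> \sum_(p <- s) G p.
Proof.
move=> FG; elim: s => [|p s IH].
  by rewrite big_nil (_ : (fun n => _) = fun=> 0); [exact: cvg_cst|apply/funext => n;
    rewrite big_nil].
rewrite big_cons (_ : (fun n => _) = fun n => F n p + \sum_(p <- s) F n p); last first.
  by apply/funext => n; rewrite big_cons.
exact: cvgD.
Qed.

Let v_ac : ac v.
Proof.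
apply: (ac_of_modulus C0) => c l c0 fl.
have cv : \sum_(p <- l) `|V n p.2 - V n p.1| @[n --> \oo] --> \sum_(p <- l) `|v p.2 - v p.1|.
  by apply: cvg_sum_seq => p; apply: cvg_norm; exact: cvgB.
rewrite -(cvg_lim _ cv) //; apply: limr_le; first by apply/cvg_ex; eexists; exact: cv.
by apply: nearW => n; exact: hlf_modulus (hlf n) (kC n) c0 fl.
Qed.

Let v_lac : lac v.
Proof. by move=> a b ab; apply: ac_clamp => //; exact: ltW. Qed.

Let V_lac n : lac (V n).
Proof. by move=> a b ab; apply: ac_clamp; [exact: ltW|exact: hlf_ac (hlf n)]. Qed.

Let mln : measurable_fun posR (@ln R).
Proof. by apply: measurable_funTS; exact: measurable_ln. Qed.

Let v_sq : sq_int v.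
Proof.
have mv : measurable_fun posR v by exact: measurable_lac.
apply/sq_intP => //; apply: le_lt_trans (ltry 1).
apply: (real_fatou (F := fun n x => V n x ^+ 2)) => //.
- by move=> n; apply: measurable_funX; exact: measurable_lac.
- exact: measurable_funX.
- by move=> n x _; exact: sqr_ge0.
- by apply: aeW => x _; exact: cvg_sqr.
- move=> e e0; apply: nearW => n.
  have [_ i] := hlf_sq (hlf n).
  by rewrite -EFin_Rintegral // (hlf_norm (hlf n)) lee_fin lerDl ltW.
- by move=> x _; exact: sqr_ge0.
Qed.

Let v_ln : sq_int (fun x => ln x * v x).
Proof.
have mv : measurable_fun posR (fun x => ln x * v x).
  by apply: measurable_funM => //; exact: measurable_lac.
apply/sq_intP => //; apply: le_lt_trans (ltry C).
apply: (real_fatou (F := fun n x => (ln x * V n x) ^+ 2)) => //.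
- by move=> n; apply: measurable_funX; apply: measurable_funM => //; exact: measurable_lac.
- exact: measurable_funX.
- by move=> n x _; exact: sqr_ge0.
- by apply: aeW => x _; apply: cvg_sqr; apply: cvgM => //; exact: cvg_cst.
- move=> e e0; apply: nearW => n.
  have [_ i] := hlf_ln (hlf n).
  by rewrite -EFin_Rintegral // lee_fin (le_trans (lC n)) // lerDl ltW.
- by move=> x _; exact: sqr_ge0.
Qed.

Let measurable_slope u (h : R) : lac u -> measurable_fun posR (fun x => slope u x h).
Proof.
move=> lu; have cu := lac_continuous lu; apply: measurable_funM => //.
apply: measurable_funB; last exact: measurable_lac.
apply: measurable_funTS; apply: measurableT_comp; last exact: measurable_funD.
exact: continuous_measurable_fun.
Qed.

(** Both terms are kept under one integral: a single use of Fatou's lemma then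
    bounds their sum, although neither term is known to converge. *)
Let quotient_energy (h : R) : 0 < h ->
  (\int[lam]_(x in posR) (slope v x h ^+ 2 + (ln x * v x) ^+ 2)%:E <= I%:E)%E.
Proof.
move=> h0.
have mlv u : lac u -> measurable_fun posR (fun x => (ln x * u x) ^+ 2).
  by move=> lu; apply: measurable_funX; apply: measurable_funM => //; exact: measurable_lac.
have msl u : lac u -> measurable_fun posR (fun x => slope u x h ^+ 2).
  by move=> lu; apply: measurable_funX; exact: measurable_slope.
apply: (real_fatou (F := fun n x => slope (V n) x h ^+ 2 + (ln x * V n x) ^+ 2)) => //.
- by move=> n; apply: measurable_funD; [exact: msl|exact: mlv].
- by apply: measurable_funD; [exact: msl|exact: mlv].
- by move=> n x _; rewrite addr_ge0 // sqr_ge0.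
- apply: aeW => x _; apply: cvgD; apply: cvg_sqr.
    by rewrite /slope; apply: cvgM; [exact: cvg_cst|exact: cvgB].
  by apply: cvgM => //; exact: cvg_cst.
- move=> e /energy_lim; apply: filterS => n nE.
  have [_ i] := hlf_ln (hlf n).
  under eq_integral do rewrite EFinD.
  rewrite ge0_integralD //.
  + apply: le_trans (leeD (hlf_quotient (hlf n) h0) (_ : (_ <= (log_second (V n))%:E)%E)) _.
      by rewrite EFin_Rintegral.
    by rewrite -EFinD lee_fin.
  + by move=> x _; rewrite lee_fin sqr_ge0.
  + by apply/measurable_EFinP; exact: msl.
  + by move=> x _; rewrite lee_fin sqr_ge0.
  + by apply/measurable_EFinP; exact: mlv.
- by move=> x _; rewrite addr_ge0 // sqr_ge0.
Qed.

Let derivative_energy :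
  (\int[lam]_(x in posR) (derive1 v x ^+ 2 + (ln x * v x) ^+ 2)%:E <= I%:E)%E.
Proof.
have mlv : measurable_fun posR (fun x => (ln x * v x) ^+ 2).
  by apply: measurable_funX; apply: measurable_funM => //; exact: measurable_lac.
apply: (real_fatou (F := fun n x => slope v x n.+1%:R^-1 ^+ 2 + (ln x * v x) ^+ 2)) => //.
- by move=> n; apply: measurable_funD => //; apply: measurable_funX; exact: measurable_slope.
- by apply: measurable_funD => //; apply: measurable_funX; exact: measurable_derive1_lac.
- by move=> n x _; rewrite addr_ge0 // sqr_ge0.
- apply: ae_imp (lac_derivable v_lac) => x /derivable_slope_seq dv _.
  by apply: cvgD; [exact: cvg_sqr|exact: cvg_cst].
- move=> e e0; apply: nearW => n; apply: (@le_trans _ _ I%:E).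
    by apply: quotient_energy; rewrite invr_gt0 ltr0n.
  by rewrite lee_fin lerDl ltW.
- by move=> x _; rewrite addr_ge0 // sqr_ge0.
Qed.

Let v_derive : sq_int (derive1 v) /\ energy v (derive1 v) <= I.
Proof.
have mv : measurable_fun posR (derive1 v) by exact: measurable_derive1_lac.
have [ml il] := v_ln.
have E : (\int[lam]_(x in posR) (derive1 v x ^+ 2 + (ln x * v x) ^+ 2)%:E =
   \int[lam]_(x in posR) (derive1 v x ^+ 2)%:E + (log_second v)%:E)%E.
  under eq_integral do rewrite EFinD.
  rewrite ge0_integralD //.
  - by rewrite EFin_Rintegral.
  - by move=> x _; rewrite lee_fin sqr_ge0.
  - by apply/measurable_EFinP; exact: measurable_funX.
  - by move=> x _; rewrite lee_fin sqr_ge0.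
  - by apply/measurable_EFinP; exact: measurable_funX.
have := derivative_energy; rewrite E => H.
have sd : sq_int (derive1 v).
  apply/sq_intP => //; apply: le_lt_trans (ltry I); apply: le_trans H.
  by rewrite leeDl // lee_fin log_second_ge0.
split => //; rewrite -lee_fin /energy EFinD /kinetic EFin_Rintegral //.
exact: (proj2 sd).
Qed.

Let V_bound n x : 0 <= x -> `|V n x| <= (x + C) / 2.
Proof. exact: hlf_bound (hlf n) (kC n). Qed.

(** Moments whose weight is dominated by [ln ^ 2] at both ends of the half-line
    pass to the limit, the contribution of the ends being uniformly small. *)
Let moment_limit (w : R -> R) : measurable_fun posR w ->
  (forall L x, 1 <= L -> 0 < x -> `|ln x| <= L -> `|w x| <= L) ->
  (forall L x, 1 <= L -> 0 < x -> L < `|ln x| -> `|w x| <= ln x ^+ 2 / L) ->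
  (forall n, lam.-integrable posR (EFin \o (fun x => w x * V n x ^+ 2))) ->
  lam.-integrable posR (EFin \o (fun x => w x * v x ^+ 2)) ->
  \int[lam]_(x in posR) (w x * V n x ^+ 2) @[n --> \oo] -->
  \int[lam]_(x in posR) (w x * v x ^+ 2).
Proof.
move=> mw w_in w_out iV iv; apply/cvgrPdist_le => e e0.
(* [K / L <= e / 2] bounds what both moments collect outside [S]. *)
pose K := 2 * (C + log_second v) + 1.
have K0 : 0 < K by rewrite /K; have := log_second_ge0 v; have := C0; lra.
pose L := Num.max 1 (K / (e / 2)).
have e20 : 0 < e / 2 by rewrite divr_gt0.
have L1 : 1 <= L by rewrite le_max lexx.
have L0 : 0 < L by lra.
pose S : set R := `[expR (- L), expR L]%classic.
have mS : measurable S by exact: measurable_itv.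
have SP x : 0 < x -> S x <-> `|ln x| <= L.
  move=> x0; rewrite /S /= in_itv /= ler_norml.
  by rewrite -{1 2}(lnK x0) !ler_expR.
have Spos : S `<=` posR.
  by move=> x; rewrite /S /= in_itv /= posRE => /andP[+ _]; apply: lt_le_trans; exact: expR_gt0.
have finS : (lam S < +oo)%E.
  rewrite /S lebesgue_measure_itv /=; case: ifP => _; last exact: ltry.
  by rewrite -EFinB ltry.
pose B := (expR L + C) / 2.
have inner : \int[lam]_(x in S) (w x * V n x ^+ 2) @[n --> \oo] -->
    \int[lam]_(x in S) (w x * v x ^+ 2).
  have mwS : measurable_fun S w by apply: (measurable_funS measurable_posR Spos); exact: mw.
  have [] // := @real_dct R S (fun n x => w x * V n x ^+ 2) (fun x => w x * v x ^+ 2)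
    (fun=> L * B ^+ 2) mS _ _ _ _ _.
  - by move=> n; apply: measurable_funM => //; apply: measurable_funX; exact: measurable_lac.
  - by apply: measurable_funM => //; apply: measurable_funX; exact: measurable_lac.
  - move=> n x Sx; have := Spos _ Sx; rewrite posRE => x0.
    rewrite normrM; apply: ler_pM => //; first by apply: w_in => //; exact/SP.
    have xL : x <= expR L by move: Sx; rewrite /S /= in_itv /= => /andP[].
    have VB : `|V n x| <= B.
      by apply: le_trans (V_bound n (ltW x0)) _; rewrite ler_pM2r ?invr_gt0 // lerD2r.
    have B0 : 0 <= B by apply: le_trans VB.
    by rewrite normrX ler_pXn2r ?nnegrE.
  - exact: integrable_cst_real.
  - by apply: aeW => x _; apply: cvgM; [exact: cvg_cst|exact: cvg_sqr].
have outer u : sq_int (fun x => ln x * u x) ->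
    lam.-integrable posR (EFin \o (fun x => w x * u x ^+ 2)) ->
    `|\int[lam]_(x in posR) (w x * u x ^+ 2) - \int[lam]_(x in S) (w x * u x ^+ 2)|
    <= log_second u / L.
  move=> su iu; have mD : measurable (posR `\` S) by apply: measurableD; [exact: measurable_posR|
    exact: mS].
  have E : posR = S `|` (posR `\` S) by rewrite setDUK.
  rewrite {1}E Rintegral_setU //; last 2 first.
  - by rewrite -E.
  - by apply/disj_set2P; rewrite setDIK.
  rewrite addrAC subrr add0r.
  have iD : lam.-integrable (posR `\` S) (EFin \o (fun x => w x * u x ^+ 2)).
    by apply: integrableS iu => //; exact: subDsetl.
  have isl : lam.-integrable posR (EFin \o (fun x => L^-1 * (ln x * u x) ^+ 2)).
    by apply: integrable_realZ => //; exact: (proj2 su).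
  have islD : lam.-integrable (posR `\` S) (EFin \o (fun x => L^-1 * (ln x * u x) ^+ 2)).
    by apply: integrableS isl => //; exact: subDsetl.
  apply: le_trans (le_normr_Rintegral _ iD) _; first exact: mD.
  rewrite /log_second mulrC -RintegralZl //; last exact: (proj2 su).
  apply: (@le_trans _ _ (\int[lam]_(x in posR `\` S) (L^-1 * (ln x * u x) ^+ 2))).
    apply: le_Rintegral => //; first exact: integrable_norm iD.
    move=> x [+ nS]; rewrite posRE => x0; rewrite normrM (ger0_norm (sqr_ge0 _)).
    rewrite exprMn [leRHS]mulrA ler_wpM2r ?sqr_ge0 // mulrC; apply: w_out => //.
    by rewrite ltNge; apply/negP => h; apply: nS; apply/(SP _ x0).
  apply: le_Rintegral_subset; [exact: mD|exact: measurable_posR|exact: subDsetl| |exact: isl].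
  by move=> x _; rewrite mulr_ge0 ?sqr_ge0 // invr_ge0 ltW.
move/cvgrPdist_le/(_ _ e20): inner; apply: filterS => n nS.
have o1 := outer _ v_ln iv; have o2 := outer _ (hlf_ln (hlf n)) (iV n).
set a := \int[lam]_(x in posR) (w x * v x ^+ 2) in o1 *.
set a' := \int[lam]_(x in posR) (w x * V n x ^+ 2) in o2 *.
set b := \int[lam]_(x in S) (w x * v x ^+ 2) in o1 nS.
set b' := \int[lam]_(x in S) (w x * V n x ^+ 2) in o2 nS.
rewrite (_ : a - a' = (a - b) - (a' - b') + (b - b')); last by ring.
apply: le_trans (ler_normD _ _) _.
apply: le_trans (lerD (ler_normB _ _) nS) _.
rewrite [leRHS]splitr lerD2r; apply: le_trans (lerD o1 o2) _.
rewrite -mulrDl ler_pdivrMr //.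
apply: (@le_trans _ _ K).
  by have := lC n; have := C0; have := log_second_ge0 v; rewrite /K; lra.
by rewrite -ler_pdivrMl // mulrC le_max lexx orbT.
Qed.

(** The constraints survive in the limit because neither mass nor logarithmic
    mean can escape to [0] or to infinity; the energy can only drop. *)
Lemma minimizing_limit : [/\ lac v, forall x, x <= 0 -> v x = 0, sq_int v,
    sq_int (derive1 v) & sq_int (fun x => ln x * v x)] /\
  [/\ \int[lam]_(x in posR) v x ^+ 2 = 1, log_mean v = 0 & energy v (derive1 v) <= I].
Proof.
have [sd eI] := v_derive; split; split => //.
- have one u : \int[lam]_(x in posR) u x ^+ 2 = \int[lam]_(x in posR) (1 * u x ^+ 2).
    by apply: eq_Rintegral => x _; rewrite mul1r.
  have i1 u : sq_int u -> lam.-integrable posR (EFin \o (fun x => 1 * u x ^+ 2)).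
    by move=> [_]; exact: integrable_realZ.
  have cv := @moment_limit (fun=> 1) _ _ _ (fun n => i1 _ (hlf_sq (hlf n))) (i1 _ v_sq).
  rewrite one -(cvg_lim _ (cv _ _ _)) //.
  + rewrite (_ : (fun n => _) = fun=> 1) ?lim_cst //.
    by apply/funext => n; rewrite -one; exact: hlf_norm (hlf n).
  + by move=> L x L1 _ _; rewrite normr1.
  + move=> L x L1 _ Lx; rewrite normr1 ler_pdivlMr ?mul1r; last by lra.
    rewrite -(real_normK (num_real (ln x))) expr2.
    by have := ltW Lx; nra.
- have cv := @moment_limit (@ln R) mln _ _
    (fun n => log_mean_integrable (hlf_sq (hlf n)) (hlf_ln (hlf n)))
    (log_mean_integrable v_sq v_ln).
  rewrite /log_mean -(cvg_lim _ (cv _ _)) //.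
  + rewrite (_ : (fun n => _) = fun=> 0) ?lim_cst //.
    by apply/funext => n; exact: (proj2 (adm n)).
  + move=> L x L1 _ Lx; rewrite ler_pdivlMr; last by lra.
    by rewrite -(real_normK (num_real (ln x))) expr2 ler_wpM2l // ltW.
Qed.

End Limit.

(** * Existence of a minimizer *)

Section Tent.
Context {R : realType}.
Local Notation lam := (@lebesgue_measure R).
Local Notation posR := (@posR R).

(** A single explicit signal, showing that the infimum of the energies is taken
    over a nonempty set. *)
Definition tent (x : R) : R := Num.max 0 (1 - `|x - 1|).

Lemma max0_lip (a b : R) : `|Num.max 0 b - Num.max 0 a| <= `|b - a|.
Proof.
have h1 := ler_norm (b - a); have h2 := ler_norm (a - b); rewrite distrC in h2.
by rewrite ler_norml !maxEle; case: (leP 0 a) => a0; case: (leP 0 b) => b0;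
  apply/andP; split; lra.
Qed.

Lemma tent_lip x y : `|tent y - tent x| <= `|y - x|.
Proof.
apply: le_trans (max0_lip _ _) _.
rewrite (_ : _ - _ - _ = `|x - 1| - `|y - 1|); last by ring.
apply: le_trans (ler_dist_dist _ _) _.
by rewrite distrC (_ : y - 1 - (x - 1) = y - x) //; ring.
Qed.

Lemma tent_itv x : 0 <= tent x <= 1.
Proof. by rewrite /tent le_max lexx ge_max ler01 gerBl normr_ge0. Qed.

Lemma tent_le x : 0 <= x -> tent x <= x.
Proof.
by move=> x0; rewrite ge_max x0 /=; have := ler_norm (1 - x); rewrite distrC; lra.
Qed.

Lemma ac_id : ac (@id R).
Proof.
move=> e e0; exists e => // l /andP[al _]; apply: le_lt_trans.
rewrite big_seq [leRHS]big_seq; apply: ler_sum => p pl.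
by rewrite ger0_norm // subr_ge0; exact: (allP al).
Qed.

Lemma lac_tent : lac tent.
Proof.
move=> a b ab; apply: ac_clamp; first exact: ltW.
by apply: (ac_lip ler01 ac_id) => x y; rewrite mul1r tent_lip.
Qed.

Lemma tent_neg x : x <= 0 -> tent x = 0.
Proof.
move=> x0; apply/max_idPl; have := ler_norm (1 - x); rewrite distrC; lra.
Qed.

Lemma sq_int_unit (w : R -> R) : measurable_fun posR w ->
  {ae lam, forall x, 0 < x -> w x ^+ 2 <= \1_(`[0, 2]%classic : set R) x} -> sq_int w.
Proof.
move=> mw wle; apply/sq_intP => //.
apply: (@le_lt_trans _ _ (\int[lam]_(x in posR) (\1_(`[0%R, 2%R]%classic : set R) x)%:E)%E).
  apply: ae_ge0_le_integral => //.
  - by move=> x _; rewrite lee_fin sqr_ge0.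
  - by apply/measurable_EFinP; exact: measurable_funX.
  - by apply/measurable_EFinP; exact: measurable_indic.
  - by apply: ae_imp wle => x H; rewrite posRE lee_fin.
rewrite integral_indic //.
apply: (@le_lt_trans _ _ (lam (`[0%R, 2%R]%classic : set R))).
  by apply: le_measure; rewrite ?inE //; apply: measurableI => //; exact: measurable_itv.
by rewrite lebesgue_measure_itv /= lte_fin ltr0n /= -EFinB ltry.
Qed.

Lemma tent_out x : 2 <= x -> tent x = 0.
Proof.
by move=> x2; apply/max_idPl; have := ler_norm (x - 1); lra.
Qed.

Lemma indic02 (x a : R) : 0 < x -> a <= 1 -> (2 < x -> a <= 0) ->
  a <= \1_(`[0, 2]%classic : set R) x.
Proof.
move=> x0 a1 a0; rewrite indicE; case: (leP x 2) => x2.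
  by rewrite mem_set //= in_itv /= (ltW x0).
rewrite memNset ?a0 //= in_itv /= => /andP[_]; rewrite leNgt x2.
by [].
Qed.

Lemma sq_int_tent : sq_int tent.
Proof.
apply: sq_int_unit; first by apply: measurable_lac; exact: lac_tent.
apply: aeW => x x0; apply: indic02 => // [|x2].
  by have /andP[t0 t1] := tent_itv x; rewrite expr_le1.
by rewrite tent_out ?expr0n // ltW.
Qed.

Lemma sq_int_ln_tent : sq_int (fun x => ln x * tent x).
Proof.
apply: sq_int_unit.
  by apply: measurable_funM; [apply: measurable_funTS; exact: measurable_ln|
    apply: measurable_lac; exact: lac_tent].
apply: aeW => x x0; apply: indic02 => // [|x2]; last first.
  by rewrite tent_out ?mulr0 ?expr0n // ltW.
suff : `|ln x * tent x| <= 1 by move=> h; rewrite -(real_normK (num_real _)) expr_le1.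
have up : ln x <= x - 1.
  by have := expR_ge1Dx (ln x); rewrite lnK ?posrE //; lra.
have lo : x * (- ln x) <= 1 - x.
  have := expR_ge1Dx (- ln x); rewrite expRN lnK ?posrE // => h.
  have := ler_wpM2l (ltW x0) h; rewrite mulfV ?gt_eqF //; lra.
have /andP[t0 t1] := tent_itv x; have tx := tent_le (ltW x0).
have [l0|/ltW l0] := leP (ln x) 0; first by rewrite ler_norml; apply/andP; split; nra.
have [x2|x2] := leP x 2; first by rewrite ler_norml; apply/andP; split; nra.
by rewrite tent_out ?mulr0 ?normr0 // ltW.
Qed.

Lemma sq_int_derive_tent : sq_int (derive1 tent).
Proof.
apply: sq_int_unit; first by apply: measurable_derive1_lac; exact: lac_tent.
apply: ae_imp (lac_derivable lac_tent) => x dt x0; apply: indic02 => // [|x2].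
  have cv2 := cvg_sqr (derivable_slope_seq dt).
  rewrite -(cvg_lim _ cv2) //; apply: limr_le; first by apply/cvg_ex; eexists; exact: cv2.
  apply: nearW => n; rewrite -(real_normK (num_real _)) expr_le1 //.
  rewrite /slope normrM ger0_norm ?invr_ge0 // ler_pdivrMl ?ltr0n // mulr1.
  by apply: le_trans (tent_lip _ _) _; rewrite addrK ger0_norm // invr_ge0.
rewrite derive1_near0 ?expr0n //.
by apply: filterS (lt_nbhsr x2) => y y2; rewrite tent_out // ltW.
Qed.

Lemma tent_nonzero : nonzero_signal (real_signal tent).
Proof.
move=> [N [mN N0 NN]].
have : (lam `]0%R, 1%R[%classic <= lam N)%E.
  apply: le_measure; rewrite ?inE //.
  move=> x /=; rewrite in_itv /= => /andP[x0 x1]; apply: NN => /= -[].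
  move=> t0; have : 1 - `|x - 1| <= tent x by rewrite le_max lexx orbT.
  by rewrite t0 ler0_norm; lra.
by rewrite N0 lebesgue_measure_itv /= lte_fin ltr01 sube0 lee_fin ler10.
Qed.

Lemma admissible_exists : exists u phi : R -> R, admissible u phi.
Proof.
have dt := real_signal_dom lac_tent tent_neg sq_int_tent sq_int_derive_tent sq_int_ln_tent.
by have [u [phi [au _]]] := signal_competitor dt tent_nonzero; exists u, phi.
Qed.

End Tent.

Section Existence.
Context {R : realType}.
Local Notation lam := (@lebesgue_measure R).
Local Notation posR := (@posR R).

Definition energies : set R :=
  [set e | exists u phi : R -> R, admissible u phi /\ e = energy u phi].

Lemma energies_has_inf : has_inf energies.
Proof.
split.
  by have [u [phi a]] := @admissible_exists R; exists (energy u phi), u, phi.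
exists 0 => _ [u [phi [_ ->]]].
by rewrite addr_ge0 ?kinetic_ge0 ?log_second_ge0.
Qed.

(** The direct method: a minimizing sequence has bounded energy, hence is
    equicontinuous and bounded at each point, and a pointwise limit of a
    subsequence attains the infimum. *)
Lemma energy_minimizer : exists v : R -> R,
  [/\ lac v, forall x, x <= 0 -> v x = 0, sq_int v,
    sq_int (derive1 v) & sq_int (fun x => ln x * v x)] /\
  [/\ \int[lam]_(x in posR) v x ^+ 2 = 1, log_mean v = 0 &
    energy v (derive1 v) <= inf energies].
Proof.
set I := inf energies.
have /choice[UP UPP] : forall n, exists up : (R -> R) * (R -> R),
    admissible up.1 up.2 /\ energy up.1 up.2 <= I + n.+1%:R^-1.
  move=> n; have n0 : (0 : R) < n.+1%:R^-1 by rewrite invr_gt0 ltr0n.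
  have [_ [u [phi [a ->]]] h] := inf_adherent n0 energies_has_inf.
  by exists (u, phi); split => //=; exact: ltW.
pose C := I + 1.
have eC n : energy (UP n).1 (UP n).2 <= C.
  have [_ h] := UPP n; apply: le_trans h _; rewrite lerD2l invf_le1 ?ltr0n //.
  by rewrite ler1n.
have hU n : half_line_function (UP n).1 (UP n).2 by have [[]] := UPP n.
have kU n : kinetic (UP n).2 <= C.
  by apply: le_trans (eC n); rewrite lerDl log_second_ge0.
have C0 : 0 <= C by apply: le_trans (kinetic_ge0 _) (kU 0%N).
have bU n x : `|(UP n).1 x| <= (`|x| + C) / 2.
  have [x0|/ltW x0] := leP 0 x.
    by rewrite (ger0_norm x0); exact: hlf_bound (hU n) (kU n) x0.
  by rewrite (hlf_neg (hU n) x0) normr0 divr_ge0 // addr_ge0.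
have [v [sigma [sk cv]]] := pointwise_subsequence bU (hlf_equicontinuous hU kU).
exists v; apply: (@minimizing_limit R (fun k => (UP (sigma k)).1)
  (fun k => (UP (sigma k)).2) v C I) => //.
- by move=> n; have [] := UPP (sigma n).
- move=> e e0; near=> k; have [_ h] := UPP (sigma k); apply: le_trans h _.
  rewrite lerD2l; apply: (@le_trans _ _ k.+1%:R^-1).
    by rewrite lef_pV2 ?posrE ?ltr0n // ler_nat ltnS.
  apply/ltW; rewrite -[e]invrK ltf_pV2 ?posrE ?invr_gt0 ?ltr0n //.
  by near: k; exact: near_infty_gtS.
Unshelve. all: by end_near. Qed.

End Existence.

Theorem theorem3p1 (R : realType) :
  exists f0 : R -> R[i],
    [/\ dom_LS f0,
        nonzero_signal f0 &
        forall f : R -> R[i],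
          dom_LS f -> nonzero_signal f -> LS f0 <= LS f].
Proof.
have [v [[lv neg sv sd sl] [v1 v0 vI]]] := @energy_minimizer R.
exists (real_signal v); split.
- exact: real_signal_dom.
- exact: real_signal_nonzero.
- move=> f df nz; have [u [phi [au le_f]]] := signal_competitor df nz.
  rewrite LS_real_signal //; apply: le_trans vI (le_trans _ le_f).
  apply: ge_inf; last by exists u, phi.
  by have [] := @energies_has_inf R.
Qed.
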